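(* For integers $n\ge 1$ and $0\le m\le n$ consider the formula $$( * )\qquad \{d_n(-1)^m L_{n,m}\}=d_n(-1)^m J_{n,m}.$$ The following are equivalent: (a) the formula $( * )$ holds for some integers $n\ge1$ and $m$ with $0\le m\le n$; (b) there is an integer $m\ge 0$ such that the formula $( * )$ holds for all sufficiently large $n$; (c) Euler's constant $\gamma$ is a rational number.
   Context: $\gamma=\lim_{n\to\infty}\left(\sum_{k=1}^n \frac1k-\ln n\right)$ is Euler's constant. $d_n:=\mathrm{LCM}(1,\ldots,n)$ is the least common multiple of the first $n$ positive integers. $\{x\}=x-\lfloor x\rfloor$ is the fractional part of the real number $x$. $P_n^*$ is the shifted Legendre polynomial $$P_n^*(u)=\sum_{k=0}^n\binom{n}{k}\binom{n+k}{k}(-1)^{n+k}u^k .$$ For integers $0\le m\le n$, $$L_{n,m}:=\sum_{k=0}^n\binom{n}{k}\binom{n+k}{k}(-1)^{n+k}\ln(n-m+k+1),\qquad J_{n,m}:=\int_0^1 u^{n-m}P_n^*(u)\left(\frac{1}{\ln u}+\frac{1}{1-u}\right)du .$$ *)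

(* Defs.v *)
(* Stdlib real numbers with Coquelicot's total limits and Riemann integrals. *)
From Stdlib Require Export Reals Arith List QArith.QArith_base Qreals.
From Coquelicot Require Export Coquelicot.
Open Scope R_scope.

Definition euler_gamma : R :=
  real (Lim_seq (fun n => sum_n_m (fun k => 1 / INR k) 1 n - ln (INR n))).

Definition lcm_upto (n : nat) : nat := fold_right Nat.lcm 1%nat (seq 1 n).

Definition legendre_coef (n k : nat) : R :=
  Binomial.C n k * Binomial.C (n + k) k * (-1) ^ (n + k).

Definition shifted_legendre (n : nat) (u : R) : R :=
  sum_n (fun k => legendre_coef n k * u ^ k) n.

(* Meant for m <= n only: [n - m] is truncated subtraction. *)
Definition legendre_log (n m : nat) : R :=
  sum_n (fun k => legendre_coef n k * ln (INR (n - m + k + 1))) n.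

(* The integrand is bounded and continuous on the open interval, with finite
   limits at 0 and 1, so this is a proper Riemann integral: the conventional
   values of [ln] and of division at the two endpoints do not affect it. *)
Definition legendre_integral (n m : nat) : R :=
  RInt (fun u => u ^ (n - m) * shifted_legendre n u * (1 / ln u + 1 / (1 - u)))
    0 1.

Definition frac_formula (n m : nat) : Prop :=
  frac_part (INR (lcm_upto n) * (-1) ^ m * legendre_log n m)
  = INR (lcm_upto n) * (-1) ^ m * legendre_integral n m.

(* Main.v *)
(* Write f(u) = 1/ln u + 1/(1-u) and c_s for the integral of u^s f over [0,1].
   Comparing c_s - c_(s+1) with a logarithm gives c_s = ln(s+1) + gamma - H_s, so
   J_(n,m) = L_(n,m) + gamma - A, where A is a combination of harmonic numbers
   that orthogonality of P_n^* reduces to H_0, ..., H_n; hence d_n A is an integer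
   and (a) forces d_n gamma to be one.

   Conversely, if gamma is rational then d_n J_(n,0) and d_n L_(n,0) differ by an
   integer for large n, and it remains to see that 0 <= d_n J_(n,0) < 1. The function
   f is an average over t and th in (0,1] of
     K_(t,th)(u) = t u^t (th + (1-th) u)^(-t-1),
   and n integrations by parts show that the integral of u^n P_n^* K_(t,th) is
     t (t+1)...(t+n) / n! th^n times that of u^(n+t) (1-u)^n (th + (1-th) u)^(-t-1-n),
   which lies between 0 and (n+1) 4^(1-n). Averages are handled as limits of Riemann
   sums of monotone functions, so no iterated integral is needed.

   Finally d_(6k) divides d_k (6k)!/((3k)! (2k)! k!), and this multinomial
   coefficient is at most 432^k; as 432 * 9 < 4^6, d_n = o(r^n) for some r < 4. *)
Require Import Defs.
From Stdlib Require Import Reals Arith ZArith List QArith.QArith_base Qreals Lia Lra.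
From Coquelicot Require Import Coquelicot.
From mathcomp Require all_boot.
Open Scope R_scope.

(** * An upper bound for the least common multiple *)

(** Here a and b are the integer parts of 3k/q and 2k/q. As q exceeds k, a is at most 2 and b at
    most 1, which leaves six linear cases. *)
Lemma floor_632_strict (k q a b : nat) :
  (a * q <= 3 * k -> 3 * k < S a * q -> b * q <= 2 * k -> 2 * k < S b * q ->
   k < q -> q <= 6 * k -> (a + b + 1) * q <= 6 * k)%nat.
Proof.
intros.
assert (a <= 2)%nat by nia.
assert (b <= 1)%nat by nia.
destruct a as [|[|[|a]]]; destruct b as [|[|b]]; lia.
Qed.

Section Multinomial.
Import all_boot.
Local Open Scope nat_scope.

(** Legendre's formula, padded with zero terms up to a common bound so that several factorials can
    be compared term by term. *)
Lemma logn_fact_ge p n m : prime p -> n <= m ->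
  logn p n`! = \sum_(1 <= i < m.+1) n %/ p ^ i.
Proof.
move=> pp le; rewrite logn_fact // [RHS](@big_cat_nat _ _ _ n.+1) //=.
rewrite [X in _ = _ + X]big_nat_cond [X in _ = _ + X]big1 ?addn0 // => i /andP[/andP[lt _] _].
apply: divn_small; exact: ltn_trans lt (ltn_expl i (prime_gt1 pp)).
Qed.

(** The multinomial coefficient (6k)!/((3k)! (2k)! k!), as a product of binomials so that it is
    visibly a natural number. *)
Definition multinomial_632 k := 'C(6 * k, 3 * k) * 'C(3 * k, k).

Lemma multinomial_632_fact k :
  (6 * k)`! = multinomial_632 k * ((3 * k)`! * ((2 * k)`! * k`!)).
Proof.
have le1 : 3 * k <= 6 * k by rewrite leq_mul2r orbT.
have le2 : k <= 3 * k by rewrite leq_pmull.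
have e1 := bin_fact le1; have e2 := bin_fact le2.
have d1 : 6 * k - 3 * k = 3 * k by rewrite -mulnBl.
have d2 : 3 * k - k = 2 * k by rewrite -[X in _ - X]mul1n -mulnBl.
rewrite d1 in e1; rewrite d2 in e2.
rewrite -e1 -[X in _ * (X * _) = _]e2 /multinomial_632.
by rewrite [X in _ * X = _]mulnC -[RHS]mulnA; congr (_ * _); rewrite mulnCA [(2 * k)`! * _]mulnC.
Qed.

Lemma multinomial_632_gt0 k : 0 < multinomial_632 k.
Proof. by rewrite muln_gt0 !bin_gt0 leq_mul2r orbT /= leq_pmull. Qed.

(** Each binomial is bounded by keeping one term of an expansion: of (1+1)^(6k) for the first, of
    (2+1)^(3k) for the second, where the term carries 2^(2k). Then 64 * 27 / 4 = 432. *)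
Lemma multinomial_632_le k : multinomial_632 k <= 432 ^ k.
Proof.
have h1 : 'C(6 * k, 3 * k) <= 2 ^ (6 * k).
  rewrite -[2]/(1 + 1) expnDn.
  have lt : 3 * k < (6 * k).+1 by rewrite ltnS leq_mul2r orbT.
  rewrite (bigD1 (Ordinal lt)) //= !exp1n !muln1; exact: leq_addr.
have h2 : 'C(3 * k, k) * 4 ^ k <= 27 ^ k.
  rewrite -[27]/(3 ^ 3) -expnM -[X in _ <= X ^ _]/(2 + 1) expnDn.
  have lt : k < (3 * k).+1 by rewrite ltnS leq_pmull.
  rewrite (bigD1 (Ordinal lt)) //= !exp1n !muln1.
  have -> : 3 * k - k = 2 * k by rewrite -[X in _ - X]mul1n -mulnBl.
  rewrite (expnM 2 2); exact: leq_addr.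
rewrite /multinomial_632; apply: (leq_trans (leq_mul h1 (leqnn _))).
rewrite expnM -[2 ^ 6]/(16 * 4) expnMn -mulnA [4 ^ k * _]mulnC.
have -> : 432 ^ k = 16 ^ k * 27 ^ k by rewrite -expnMn.
by rewrite leq_mul2l h2 orbT.
Qed.

(** The boolean counts as 1 on the range where the floor inequality is strict; there k/q has integer
    part 0. Elsewhere this is superadditivity of the floor. *)
Lemma divn_632 k q : 0 < q ->
  3 * k %/ q + (2 * k %/ q + k %/ q) + (k < q <= 6 * k) <= 6 * k %/ q.
Proof.
move=> q0; rewrite leq_divRL //.
have ha := leq_divM (3 * k) q; have hb := leq_divM (2 * k) q.
have hc := leq_divM k q.
case: (boolP (k < q <= 6 * k)) => [/andP[kq q6]|_].
  rewrite (divn_small kq) addn0; apply/leP.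
  by apply: floor_632_strict; apply/leP => //; rewrite -[S _]addn1 addn1 ltn_ceil.
have -> : 6 * k = 3 * k + (2 * k + k) by rewrite -[X in _ + (_ + X)]mul1n -!mulnDl.
by rewrite addn0 !mulnDl leq_add // leq_add.
Qed.

(** Argue one prime p at a time. Let p^e be the exact power of p in j and p^f the largest power of p
    up to k. Then p^f divides D, and each i with f < i <= e satisfies k < p^i <= 6k, hence adds at
    least one factor p to the multinomial coefficient by [divn_632]. *)
Lemma dvdn_multinomial_632 k j D : (forall i, 0 < i <= k -> i %| D) -> 0 < D ->
  0 < j <= 6 * k -> j %| D * multinomial_632 k.
Proof.
move=> hD D0 /andP[j0 jk].
have M0 := multinomial_632_gt0 k.
apply/dvdn_partP => // p; rewrite mem_primes => /andP[pp _].
rewrite p_part pfactor_dvdn //; last by rewrite muln_gt0 D0.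
rewrite lognM //.
set e := logn p j.
have pe : p ^ e <= 6 * k by apply: leq_trans (dvdn_leq j0 (pfactor_dvdnn p j)) jk.
have k0 : 0 < k by case: k jk {hD M0 pe} => //; rewrite muln0 leqn0 => /eqP j00; rewrite j00 in j0.
set f := trunc_log p k.
have fk : p ^ f <= k by apply: trunc_logP => //; exact: prime_gt1.
have fD : f <= logn p D.
  by rewrite -pfactor_dvdn //; apply: hD; rewrite fk expn_gt0 prime_gt0.
suff : e - f <= logn p (multinomial_632 k) by move=> h; rewrite -leq_subLR (leq_trans _ h) // leq_sub2l.
have F0 m : 0 < m`! by exact: fact_gt0.
have G0 : 0 < (2 * k)`! * k`! by rewrite muln_gt0 !F0.
have H0 : 0 < (3 * k)`! * ((2 * k)`! * k`!) by rewrite muln_gt0 G0 F0.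
have := congr1 (logn p) (multinomial_632_fact k).
rewrite (lognM p M0 H0) (lognM p (F0 _) G0) (lognM p (F0 _) (F0 _)).
have le3 : 3 * k <= 6 * k by rewrite leq_mul2r orbT.
have le2 : 2 * k <= 6 * k by rewrite leq_mul2r orbT.
have le1 : k <= 6 * k by rewrite leq_pmull.
rewrite (@logn_fact_ge p _ _ pp (leqnn (6 * k))) (@logn_fact_ge p _ _ pp le3) (@logn_fact_ge p _ _ pp le2) (@logn_fact_ge p _ _ pp le1).
rewrite -!big_split /= => eqM.
have le : \sum_(1 <= i < (6 * k).+1) (3 * k %/ p ^ i + (2 * k %/ p ^ i + k %/ p ^ i) + (k < p ^ i <= 6 * k))
   <= logn p (multinomial_632 k) + \sum_(1 <= i < (6 * k).+1) (3 * k %/ p ^ i + (2 * k %/ p ^ i + k %/ p ^ i)).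
  by rewrite -eqM; apply: leq_sum => i _; apply: divn_632; rewrite expn_gt0 prime_gt0.
move: le; rewrite big_split /= addnC leq_add2r; apply: leq_trans.
case: (leqP e f) => [|fe]; first by rewrite -subn_eq0 => /eqP ->.
have e6 : e <= 6 * k by apply: leq_trans pe; apply: ltnW; apply: ltn_expl; exact: prime_gt1.
(* Cut the range at f and e and keep only the middle block, all of whose indicators equal 1. *)
rewrite (@big_cat_nat _ _ _ f.+1) //=; last by rewrite ltnS (leq_trans (ltnW fe)).
rewrite (@big_cat_nat _ _ _ e.+1 f.+1) //=; last by rewrite ltnS ltnW.
rewrite addnCA; apply: leq_trans (leq_addr _ _).
have -> : e - f = \sum_(f.+1 <= i < e.+1) 1 by rewrite sum_nat_const_nat muln1 subSS.
rewrite big_nat_cond [X in _ <= X]big_nat_cond; apply: leq_sum => i /andP[/andP[fi ie] _].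
have i6 : p ^ i <= 6 * k by apply: leq_trans pe; rewrite leq_exp2l ?prime_gt1.
have ki : k < p ^ i.
  by apply: leq_trans (trunc_log_ltn k (prime_gt1 pp)) _; rewrite leq_exp2l ?prime_gt1.
by rewrite ki i6.
Qed.
Lemma expn_pow a k : expn a k = Nat.pow a k.
Proof. by elim: k => // k IH; rewrite expnS IH. Qed.

Lemma dvdn_divide d n : d %| n <-> Nat.divide d n.
Proof.
by split=> [/dvdnP[z ->]|[z ->]]; [exists z | apply: dvdn_mull].
Qed.

Lemma divide_multinomial_632 k j D :
  (forall i, le 1 i /\ le i k -> Nat.divide i D) -> lt 0 D ->
  le 1 j /\ le j (6 * k) -> Nat.divide j (D * multinomial_632 k).
Proof.
move=> hD /ltP D0 [/leP j0 /leP jk]; apply/dvdn_divide.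
apply: dvdn_multinomial_632 => //; last by rewrite j0.
by move=> i /andP[/leP i0 /leP ik]; apply/dvdn_divide/hD.
Qed.

Lemma multinomial_632_bounds k :
  lt 0 (multinomial_632 k) /\ le (multinomial_632 k) (Nat.pow 432 k).
Proof.
split; first exact/ltP/multinomial_632_gt0.
by rewrite -expn_pow; apply/leP/multinomial_632_le.
Qed.

End Multinomial.

Lemma divide_fold_lcm (j : nat) (l : list nat) :
  In j l -> Nat.divide j (fold_right Nat.lcm 1%nat l).
Proof.
induction l as [|a l IH]; simpl; [easy|intros [->|H]].
- apply Nat.divide_lcm_l.
- apply Nat.divide_trans with (1 := IH H), Nat.divide_lcm_r.
Qed.

Lemma fold_lcm_divide (m : nat) (l : list nat) :
  (forall j, In j l -> Nat.divide j m) -> Nat.divide (fold_right Nat.lcm 1%nat l) m.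
Proof.
induction l as [|a l IH]; simpl; intros H.
- apply Nat.divide_1_l.
- apply Nat.lcm_least; [|apply IH; intros j Hj]; apply H; auto.
Qed.

Lemma divide_lcm_upto (n j : nat) :
  (1 <= j <= n)%nat -> Nat.divide j (lcm_upto n).
Proof. intros H; apply divide_fold_lcm, in_seq; lia. Qed.

Lemma lcm_upto_divide (n m : nat) :
  (forall j, (1 <= j <= n)%nat -> Nat.divide j m) -> Nat.divide (lcm_upto n) m.
Proof. intros H; apply fold_lcm_divide; intros j Hj; apply in_seq in Hj; apply H; lia. Qed.

Lemma lcm_upto_pos (n : nat) : (0 < lcm_upto n)%nat.
Proof.
destruct (lcm_upto n) as [|d] eqn:E; [exfalso|lia].
(* The factorial is a nonzero common multiple, which 0 cannot divide. *)
assert (D : Nat.divide (lcm_upto n) (fact n)).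
{ apply lcm_upto_divide; intros j Hj.
  assert (F : forall i, (j <= i)%nat -> Nat.divide j (fact i)).
  { induction 1 as [|i Hi IH].
    - destruct j as [|j]; [lia|]. exists (fact j); simpl; lia.
    - simpl; apply Nat.divide_add_r; [exact IH|apply Nat.divide_mul_r, IH]. }
  apply F; lia. }
rewrite E in D; destruct D as [z Hz]; generalize (lt_O_fact n); lia.
Qed.

Lemma lcm_upto_mono (n m : nat) : (n <= m)%nat -> (lcm_upto n <= lcm_upto m)%nat.
Proof.
intros H; apply Nat.divide_pos_le; [apply lcm_upto_pos|].
apply lcm_upto_divide; intros j Hj; apply divide_lcm_upto; lia.
Qed.

Lemma lcm_upto_6_le (k : nat) : (lcm_upto (6 * k) <= lcm_upto k * 432 ^ k)%nat.
Proof.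
destruct (multinomial_632_bounds k) as [M0 M1].
apply Nat.le_trans with (lcm_upto k * multinomial_632 k)%nat.
- apply Nat.divide_pos_le; [apply Nat.mul_pos_pos; [apply lcm_upto_pos|exact M0]|].
  apply lcm_upto_divide; intros j Hj; apply divide_multinomial_632; [|apply lcm_upto_pos|exact Hj].
  intros i Hi; now apply divide_lcm_upto.
- apply Nat.mul_le_mono_l, M1.
Qed.

(** Strong induction through k, the ceiling of n/6: since 9 * 432 <= 9^4, the recursion gives 2520 *
    9^(4k), and 4k <= n once n >= 10. Smaller n are covered by d_9 = 2520. *)
Lemma lcm_upto_le (n : nat) : (lcm_upto n <= 2520 * 9 ^ n)%nat.
Proof.
induction n as [n IH] using (well_founded_induction Nat.lt_wf_0).
destruct (Nat.le_gt_cases n 9) as [H|H].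
- apply Nat.le_trans with (lcm_upto 9); [now apply lcm_upto_mono|].
  replace (lcm_upto 9) with 2520%nat by (vm_compute; reflexivity).
  generalize (Nat.pow_nonzero 9 n); nia.
- set (k := ((n + 5) / 6)%nat).
  generalize (Nat.div_mod_eq (n + 5) 6) (Nat.mod_upper_bound (n + 5) 6); fold k; intros E1 E2.
  apply Nat.le_trans with (lcm_upto (6 * k)); [apply lcm_upto_mono; lia|].
  apply Nat.le_trans with (1 := lcm_upto_6_le k).
  apply Nat.le_trans with ((2520 * 9 ^ k) * 432 ^ k)%nat.
  { apply Nat.mul_le_mono_r, IH; lia. }
  rewrite <- Nat.mul_assoc, <- Nat.pow_mul_l; apply Nat.mul_le_mono_l.
  apply Nat.le_trans with ((9 ^ 4) ^ k)%nat.
  + apply Nat.pow_le_mono_l; apply Nat.leb_le; vm_compute; reflexivity.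
  + rewrite <- Nat.pow_mul_r; apply Nat.pow_le_mono_r; lia.
Qed.

(** One more use of the recursion sharpens the crude base 9: per six steps the growth is 9 * 432 =
    3888, below 4^6 = 4096. *)
Lemma lcm_upto_6_exp (k : nat) : INR (lcm_upto (6 * k)) <= 2520 * 3888 ^ k.
Proof.
replace 2520 with (INR 2520) by (rewrite INR_IZR_INZ; f_equal).
replace 3888 with (INR 9 * INR 432) by (rewrite !INR_IZR_INZ, <- mult_IZR; f_equal).
rewrite <- mult_INR, <- pow_INR, <- mult_INR; apply le_INR.
apply Nat.le_trans with (1 := lcm_upto_6_le k).
rewrite Nat.pow_mul_l, Nat.mul_assoc; apply Nat.mul_le_mono_r, lcm_upto_le.
Qed.

Lemma lcm_upto_negligible :
  exists N, forall n, (N <= n)%nat ->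
    INR (lcm_upto n) * ((INR n + 1) * / 4 ^ (n - 1)) < 1.
Proof.
(* Bernoulli's inequality lets a slightly larger base absorb the factor n + 1. Since 3888/4096 =
   243/256, the final ratio 243/256 * 41/40 is still below 1. *)
assert (B : forall k, INR k * (1 / 40) <= (41 / 40) ^ k).
{ intros k; generalize (poly k (1/40) ltac:(lra)).
  replace (1 + 1 / 40) with (41/40) by field; lra. }
destruct (pow_lt_1_zero (243 / 256 * (41/40)) ltac:(rewrite Rabs_pos_eq; lra)
  (/ (2520 * 1024 * 4 * 280)) ltac:(lra)) as [K HK].
exists (6 * K + 1)%nat; intros n Hn.
set (k := ((n + 5) / 6)%nat).
generalize (Nat.div_mod_eq (n + 5) 6) (Nat.mod_upper_bound (n + 5) 6); fold k; intros E1 E2.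
assert (H1 : INR (lcm_upto n) <= 2520 * 3888 ^ k).
{ apply Rle_trans with (2 := lcm_upto_6_exp k), le_INR, lcm_upto_mono; lia. }
assert (H2 : INR n + 1 <= 280 * (41/40) ^ k).
{ apply Rle_trans with (7 * INR k); [|specialize (B k); lra].
  replace 7 with (INR 7) by (simpl; lra); rewrite <- mult_INR, <- S_INR; apply le_INR; lia. }
(* Rounding n up to 6k costs at most 4^6, because 6k <= n + 5. *)
assert (H3 : / 4 ^ (n - 1) <= 4096 * / 4096 ^ k).
{ replace (4096 ^ k) with (4 ^ (6 * k)) by (rewrite pow_mult; f_equal; lra).
  replace (6 * k)%nat with ((n - 1) + (6 * k - (n - 1)))%nat by lia.
  rewrite pow_add, Rinv_mult.
  assert (4 ^ (6 * k - (n - 1)) <= 4 ^ 6) by (apply Rle_pow; [lra|lia]).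
  assert (0 < 4 ^ (n - 1)) by (apply pow_lt; lra).
  assert (0 < 4 ^ (6 * k - (n - 1))) by (apply pow_lt; lra).
  rewrite (Rmult_comm (/ 4 ^ (n - 1))), <- Rmult_assoc.
  rewrite <- (Rmult_1_l (/ 4 ^ (n - 1))) at 1.
  apply Rmult_le_compat_r; [left; now apply Rinv_0_lt_compat|].
  apply Rmult_le_reg_r with (4 ^ (6 * k - (n - 1))); [assumption|].
  rewrite Rmult_assoc, Rinv_l; lra. }
specialize (HK k ltac:(lia)); rewrite Rabs_pos_eq in HK by (apply pow_le; lra).
apply Rle_lt_trans with ((2520 * 3888 ^ k) * ((280 * (41/40) ^ k) * (4096 * / 4096 ^ k))).
- apply Rmult_le_compat; [apply pos_INR| |exact H1|].
  + apply Rmult_le_pos; [generalize (pos_INR n); lra|].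
    left; apply Rinv_0_lt_compat, pow_lt; lra.
  + apply Rmult_le_compat; [generalize (pos_INR n); lra| |exact H2|exact H3].
    left; apply Rinv_0_lt_compat, pow_lt; lra.
- replace (_ * _) with ((243 / 256 * (41 / 40)) ^ k * (2520 * 1024 * 4 * 280)).
  + apply Rmult_lt_reg_r with (/ (2520 * 1024 * 4 * 280)); [lra|].
    rewrite Rmult_assoc, Rinv_r; lra.
  + replace (243/256) with (3888 * / 4096) by field.
    rewrite !Rpow_mult_distr, pow_inv; ring.
Qed.

(** * Legendre coefficients and harmonic numbers *)

Lemma sum_n_SR (a : nat -> R) (n : nat) : sum_n a (S n) = sum_n a n + a (S n) :> R.
Proof. exact (sum_Sn a n). Qed.

Lemma sum_n_first (a : nat -> R) (n : nat) :
  sum_n a (S n) = a 0%nat + sum_n (fun k => a (S k)) n :> R.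
Proof.
induction n as [|n IH].
- now rewrite sum_n_SR, !sum_O.
- rewrite sum_n_SR, IH, (sum_n_SR _ n); ring.
Qed.

Lemma sum_n_plusR (a b : nat -> R) (n : nat) :
  sum_n (fun k => a k + b k) n = sum_n a n + sum_n b n :> R.
Proof. exact (sum_n_plus a b n). Qed.

Lemma sum_n_scalR (c : R) (a : nat -> R) (n : nat) :
  sum_n (fun k => c * a k) n = c * sum_n a n :> R.
Proof. exact (sum_n_mult_l c a n). Qed.

Lemma sum_n_extR (a b : nat -> R) (n : nat) :
  (forall k, (k <= n)%nat -> a k = b k) -> sum_n a n = sum_n b n :> R.
Proof. exact (sum_n_ext_loc a b n). Qed.

(** Up to the sign (-1)^n, the n-th finite difference of q at 0. *)
Definition alt_binom_sum (n : nat) (q : nat -> R) : R :=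
  sum_n (fun k => (-1) ^ k * Binomial.C n k * q k) n.

Lemma binom_absorb (n k : nat) : (k <= n)%nat ->
  Binomial.C (S n) (S k) * INR (S k) = INR (S n) * Binomial.C n k.
Proof.
intros H; unfold Binomial.C; replace (S n - S k)%nat with (n - k)%nat by lia.
rewrite !fact_simpl, !mult_INR; field.
repeat split; try apply INR_fact_neq_0; apply not_0_INR; lia.
Qed.

Lemma alt_binom_sum_absorb (n : nat) (q : nat -> R) :
  alt_binom_sum (S n) (fun k => INR k * q k)
  = - INR (S n) * alt_binom_sum n (fun k => q (S k)).
Proof.
unfold alt_binom_sum; rewrite sum_n_first, <- sum_n_scalR.
change (INR 0) with 0; rewrite Rmult_0_l, Rmult_0_r, Rplus_0_l.
apply sum_n_extR; intros k Hk.
rewrite <- Rmult_assoc, (Rmult_assoc _ _ (INR (S k))), binom_absorb by assumption.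
simpl pow; ring.
Qed.

(** Monic polynomials kept in factored form: the degree is the length of the list, and shifting the
    argument shifts the list. *)
Definition lin_prod (l : list R) (x : R) : R :=
  fold_right (fun a p => (x + a) * p) 1 l.

Lemma lin_prod_succ (l : list R) (x : R) :
  lin_prod l (x + 1) = lin_prod (map (Rplus 1) l) x.
Proof. induction l as [|a l IH]; simpl; [reflexivity|rewrite IH; ring]. Qed.

Lemma lin_prod_app (l l' : list R) (x : R) :
  lin_prod (l ++ l') x = lin_prod l x * lin_prod l' x.
Proof. induction l as [|a l IH]; simpl; [ring|rewrite IH; ring]. Qed.

(** An n-th difference annihilates degree below n and sees only the leading term in degree n.
    Induction on the degree: in the first factor k + a, the part k lowers the order of the
    difference by absorption into the binomial, and the part a leaves a polynomial of smaller
    degree. *)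
Lemma alt_binom_sum_lin_prod (l : list R) (n : nat) : (length l <= n)%nat ->
  alt_binom_sum n (fun k => lin_prod l (INR k))
  = if (length l =? n)%nat then (-1) ^ n * INR (fact n) else 0.
Proof.
remember (length l) as m eqn:Em; revert l Em n.
induction m as [|m IH]; intros [|a r] Em n Hn; try discriminate.
- destruct n as [|n].
  + unfold alt_binom_sum; rewrite sum_O; unfold Binomial.C; simpl; field.
  + simpl Nat.eqb; cbv iota. unfold alt_binom_sum.
    replace 0 with ((-1 + 1) ^ (S n)) by (replace (-1 + 1) with 0 by ring; apply pow_i; lia).
    rewrite binomial, <- sum_n_Reals; apply sum_n_extR; intros k _.
    rewrite pow1; simpl lin_prod; ring.
- destruct n as [|n]; [lia|]; injection Em as Em.
  replace (alt_binom_sum _ _) with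
    (alt_binom_sum (S n) (fun k => INR k * lin_prod r (INR k))
     + a * alt_binom_sum (S n) (fun k => lin_prod r (INR k))).
  + rewrite alt_binom_sum_absorb, (IH r) by (assumption || lia).
    replace (m =? S n)%nat with false by (symmetry; apply Nat.eqb_neq; lia).
    replace (alt_binom_sum n _) with
      (alt_binom_sum n (fun k => lin_prod (map (Rplus 1) r) (INR k))).
    * rewrite IH by (rewrite ?length_map; assumption || lia).
      simpl Nat.eqb; destruct (m =? n)%nat; [|ring].
      rewrite fact_simpl, mult_INR; simpl pow; ring.
    * apply sum_n_extR; intros k _; now rewrite <- lin_prod_succ, S_INR.
  + unfold alt_binom_sum; rewrite <- sum_n_scalR, <- sum_n_plusR.
    apply sum_n_extR; intros k _; simpl; ring.
Qed.

Lemma lin_prod_seq (k i : nat) :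
  lin_prod (map INR (seq 1 k)) (INR i) * INR (fact i) = INR (fact (i + k)).
Proof.
induction k as [|k IH]; [simpl; rewrite Nat.add_0_r; ring|].
rewrite seq_S, map_app, lin_prod_app.
replace (i + S k)%nat with (S (i + k)) by lia.
rewrite fact_simpl, mult_INR, <- IH.
change (lin_prod (map INR _) _) with ((INR i + INR (S k)) * 1) at 2.
rewrite <- (plus_INR i (S k)); replace (i + S k)%nat with (S (i + k)) by lia; ring.
Qed.

(** This exhibits the second binomial of [legendre_coef] as a polynomial in k of degree n, so that
    sums of Legendre coefficients become finite differences. *)
Lemma binom_lin_prod (n k : nat) :
  Binomial.C (n + k) k = lin_prod (map INR (seq 1 n)) (INR k) / INR (fact n).
Proof.
unfold Binomial.C; replace (n + k - k)%nat with n by lia.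
rewrite (Nat.add_comm n k), <- lin_prod_seq; field; split; apply INR_fact_neq_0.
Qed.

Lemma sign_sq (n : nat) : (-1) ^ n * (-1) ^ n = 1.
Proof. rewrite <- pow_add, <- (pow_1_even n); f_equal; lia. Qed.

(** The value of P_n^* at 1; it makes gamma enter J with coefficient 1. *)
Lemma legendre_coef_sum (n : nat) : sum_n (legendre_coef n) n = 1 :> R.
Proof.
replace (sum_n _ n) with
  ((-1) ^ n / INR (fact n) * alt_binom_sum n (fun k => lin_prod (map INR (seq 1 n)) (INR k))).
- rewrite alt_binom_sum_lin_prod; rewrite length_map, length_seq; [|lia].
  rewrite Nat.eqb_refl; transitivity ((-1) ^ n * (-1) ^ n); [field; apply INR_fact_neq_0|apply sign_sq].
- unfold alt_binom_sum; rewrite <- sum_n_scalR; apply sum_n_extR; intros k _.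
  unfold legendre_coef; rewrite binom_lin_prod, pow_add; field; apply INR_fact_neq_0.
Qed.

(** Orthogonality of P_n^* to u^i, in algebraic form: k + i + 1 is one of the factors (k+1)...(k+n),
    and cancelling it leaves degree n - 1, killed by the n-th difference. *)
Lemma legendre_orthogonal (n i : nat) : (i < n)%nat ->
  sum_n (fun k => legendre_coef n k * (1 / INR (S (k + i)))) n = 0 :> R.
Proof.
intros H.
set (l := map INR (seq 1 i) ++ map INR (seq (2 + i) (n - i - 1))).
transitivity ((-1) ^ n / INR (fact n) * alt_binom_sum n (fun k => lin_prod l (INR k))).
- unfold alt_binom_sum; rewrite <- sum_n_scalR; apply sum_n_extR; intros k _.
  unfold legendre_coef; rewrite binom_lin_prod, pow_add.
  replace (seq 1 n) with (seq 1 i ++ (S i :: seq (2 + i) (n - i - 1))).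
  + rewrite map_app; unfold l; rewrite !lin_prod_app; rewrite map_cons.
    change (lin_prod (INR (S i) :: _) (INR k)) with
      ((INR k + INR (S i)) * lin_prod (map INR (seq (2 + i) (n - i - 1))) (INR k)).
    rewrite <- (plus_INR k (S i)); replace (k + S i)%nat with (S (k + i)) by lia.
    field; split; [apply INR_fact_neq_0|apply not_0_INR; lia].
  + transitivity (seq 1 (i + S (n - i - 1))); [|f_equal; lia].
    symmetry; apply seq_app.
- rewrite alt_binom_sum_lin_prod; unfold l; rewrite length_app, !length_map, !length_seq; [|lia].
  replace (_ =? n)%nat with false by (symmetry; apply Nat.eqb_neq; lia); ring.
Qed.

(** * Integrality and denominators of harmonic numbers *)

Definition is_int (x : R) : Prop := exists z : Z, x = IZR z.

Lemma is_int_plus (x y : R) : is_int x -> is_int y -> is_int (x + y).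
Proof. intros [a ->] [b ->]; exists (a + b)%Z; now rewrite plus_IZR. Qed.

Lemma is_int_mult (x y : R) : is_int x -> is_int y -> is_int (x * y).
Proof. intros [a ->] [b ->]; exists (a * b)%Z; now rewrite mult_IZR. Qed.

Lemma is_int_INR (n : nat) : is_int (INR n).
Proof. exists (Z.of_nat n); apply INR_IZR_INZ. Qed.

Lemma is_int_sign (n : nat) : is_int ((-1) ^ n).
Proof.
induction n as [|n IH]; [now exists 1%Z|].
apply is_int_mult; [now exists (-1)%Z|exact IH].
Qed.

Lemma is_int_sum_n (a : nat -> R) (n : nat) :
  (forall k, (k <= n)%nat -> is_int (a k)) -> is_int (sum_n a n).
Proof.
induction n as [|n IH]; intros H.
- rewrite sum_O; apply H; lia.
- rewrite sum_n_SR; apply is_int_plus; [apply IH; intros k Hk|]; apply H; lia.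
Qed.

Lemma is_int_binom (n k : nat) : (k <= n)%nat -> is_int (Binomial.C n k).
Proof.
revert k; induction n as [|n IH]; intros k Hk.
- replace k with 0%nat by lia; exists 1%Z; unfold Binomial.C; simpl; field.
- destruct k as [|k].
  + exists 1%Z; unfold Binomial.C; rewrite Nat.sub_0_r; simpl (fact 0); simpl (INR 1).
    field; apply INR_fact_neq_0.
  + destruct (Nat.eq_dec k n) as [->|Hkn].
    * exists 1%Z; unfold Binomial.C; rewrite Nat.sub_diag; simpl (fact 0); simpl (INR 1).
      field; apply INR_fact_neq_0.
    * rewrite <- pascal by lia; apply is_int_plus; apply IH; lia.
Qed.

Lemma is_int_legendre_coef (n k : nat) : (k <= n)%nat -> is_int (legendre_coef n k).
Proof.
intros H; apply is_int_mult; [|apply is_int_sign].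
apply is_int_mult; apply is_int_binom; lia.
Qed.

Definition harmonic (s : nat) : R := sum_n_m (fun k => 1 / INR k) 1 s.

Lemma harmonic_succ (s : nat) : harmonic (S s) = harmonic s + 1 / INR (S s).
Proof. exact (sum_n_Sm (fun k => 1 / INR k) 1 s ltac:(lia)). Qed.

(** Each unit of shift adds the terms 1/(k+i+1), whose combination vanishes by orthogonality.
    Indices up to 2n thus reduce to indices up to n, whose denominators d_n clears. *)
Lemma legendre_harmonic_shift (n i : nat) : (i <= n)%nat ->
  sum_n (fun k => legendre_coef n k * harmonic (k + i)) n
  = sum_n (fun k => legendre_coef n k * harmonic k) n :> R.
Proof.
induction i as [|i IH]; intros H.
- apply sum_n_extR; intros k _; now rewrite Nat.add_0_r.
- rewrite <- IH, <- Rplus_0_r, <- (legendre_orthogonal n i), <- sum_n_plusR by lia.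
  apply sum_n_extR; intros k _; rewrite Nat.add_succ_r, harmonic_succ; ring.
Qed.

Lemma is_int_lcm_harmonic (n s : nat) : (s <= n)%nat ->
  is_int (INR (lcm_upto n) * harmonic s).
Proof.
induction s as [|s IH]; intros H.
- unfold harmonic; rewrite sum_n_m_zero by lia; exists 0%Z; apply Rmult_0_r.
- rewrite harmonic_succ, Rmult_plus_distr_l; apply is_int_plus; [apply IH; lia|].
  destruct (divide_lcm_upto n (S s) ltac:(lia)) as [z ->]; exists (Z.of_nat z).
  rewrite mult_INR, <- INR_IZR_INZ; field; apply not_0_INR; lia.
Qed.

Lemma is_int_lcm_legendre_harmonic (n i : nat) : (i <= n)%nat ->
  is_int (INR (lcm_upto n) * sum_n (fun k => legendre_coef n k * harmonic (k + i)) n).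
Proof.
intros H; rewrite legendre_harmonic_shift, <- sum_n_scalR by assumption.
apply is_int_sum_n; intros k Hk.
replace (_ * _) with (legendre_coef n k * (INR (lcm_upto n) * harmonic k)) by ring.
apply is_int_mult; [now apply is_int_legendre_coef|now apply is_int_lcm_harmonic].
Qed.

(** * Averages, integrals and real powers *)

Lemma le_eps_harmonic (x y C : R) :
  (forall N, x <= y + C / INR (S N)) -> x <= y.
Proof.
intros H; apply Rle_plus_epsilon; intros eps He.
destruct (nfloor_ex (Rabs C / eps)) as [N [_ HN]].
{ apply Rdiv_le_0_compat; [apply Rabs_pos|exact He]. }
apply Rle_trans with (1 := H N), Rplus_le_compat_l.
assert (0 < INR (S N)) by (apply lt_0_INR; lia).
apply Rle_div_l; [assumption|].
rewrite <- S_INR in HN.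
apply Rlt_div_l in HN; [|exact He].
generalize (Rle_abs C); lra.
Qed.

(** The right-endpoint Riemann sum on [0,1]; the point 0 is never sampled. *)
Definition mean (N : nat) (k : R -> R) : R :=
  sum_n (fun j => k (INR (S j) / INR (S N))) N / INR (S N).

Lemma grid_bounds (N j : nat) : (j <= N)%nat -> 0 < INR (S j) / INR (S N) <= 1.
Proof.
intros H; assert (0 < INR (S N)) by (apply lt_0_INR; lia).
split; [apply Rdiv_lt_0_compat; [apply lt_0_INR; lia|assumption]|].
apply Rle_div_l; [assumption|]; rewrite Rmult_1_l; apply le_INR; lia.
Qed.

Lemma sum_n_le_const (a : nat -> R) (c : R) (n : nat) :
  (forall j, (j <= n)%nat -> a j <= c) -> sum_n a n <= INR (S n) * c.
Proof.
induction n as [|n IH]; intros H.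
- rewrite sum_O; specialize (H 0%nat ltac:(lia)); simpl; lra.
- rewrite sum_n_SR, S_INR; specialize (H (S n) ltac:(lia)) as H1.
  specialize (IH ltac:(intros; apply H; lia)); lra.
Qed.

Lemma mean_le (N : nat) (k : R -> R) (c : R) :
  (forall t, 0 < t <= 1 -> k t <= c) -> mean N k <= c.
Proof.
intros H; assert (0 < INR (S N)) by (apply lt_0_INR; lia).
apply Rle_div_l; [assumption|]; rewrite Rmult_comm.
apply sum_n_le_const; intros j Hj; now apply H, grid_bounds.
Qed.

Lemma mean_scal (N : nat) (c : R) (k : R -> R) :
  mean N (fun t => c * k t) = c * mean N k.
Proof. unfold mean; rewrite sum_n_scalR; unfold Rdiv; ring. Qed.

Lemma mean_plus (N : nat) (k h : R -> R) :
  mean N (fun t => k t + h t) = mean N k + mean N h.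
Proof. unfold mean; rewrite sum_n_plusR; unfold Rdiv; ring. Qed.

Lemma le_mean (N : nat) (k : R -> R) (c : R) :
  (forall t, 0 < t <= 1 -> c <= k t) -> c <= mean N k.
Proof.
intros H; apply Ropp_le_cancel.
replace (- mean N k) with (mean N (fun t => -1 * k t)) by (rewrite mean_scal; ring).
apply mean_le; intros t Ht; specialize (H t Ht); lra.
Qed.

(** For a decreasing derivative, the mean value theorem places each increment of the primitive
    between the two endpoint values on its cell; the cell errors then telescope. The integral
    appears only as an increment of [Psi]. *)
Lemma mean_antitone_bounds (Psi k : R -> R) (N : nat) :
  (forall x, 0 <= x <= 1 -> is_derive Psi x (k x)) ->
  (forall x y, 0 <= x -> x <= y -> y <= 1 -> k y <= k x) ->
  0 <= Psi 1 - Psi 0 - mean N k <= (k 0 - k 1) / INR (S N).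
Proof.
intros HD Hk; set (M := INR (S N)).
assert (HM : 0 < M) by (apply lt_0_INR; lia).
assert (I : forall j, (j <= S N)%nat -> 0 <= INR j / M <= 1).
{ intros j Hj; split; [apply Rdiv_le_0_compat; [apply pos_INR|assumption]|].
  apply Rle_div_l; [assumption|]; rewrite Rmult_1_l; apply le_INR; lia. }
assert (S : forall j, (j <= N)%nat ->
  k (INR (S j) / M) / M <= Psi (INR (S j) / M) - Psi (INR j / M) <= k (INR j / M) / M).
{ intros j Hj.
  assert (E : INR (S j) / M - INR j / M = / M) by (rewrite S_INR; field; lra).
  assert (P := Rinv_0_lt_compat M HM).
  destruct (I j ltac:(lia)), (I (S j) ltac:(lia)).
  destruct (MVT_gen Psi (INR j / M) (INR (S j) / M) k) as [c [Hc Ec]];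
    rewrite ?Rmin_left, ?Rmax_right in * by lra.
  - intros x Hx; apply HD; lra.
  - intros x Hx; apply derivable_continuous_pt; exists (k x); apply is_derive_Reals, HD; lra.
  - rewrite Ec, E; split; apply Rmult_le_compat_r; try lra; apply Hk; lra. }
assert (T : forall n, (n <= N)%nat ->
  0 <= Psi (INR (Datatypes.S n) / M) - Psi 0 - sum_n (fun j => k (INR (Datatypes.S j) / M)) n / M
    <= (k 0 - k (INR (Datatypes.S n) / M)) / M).
{ induction n as [|n IH]; intros Hn.
  - rewrite sum_O; specialize (S 0%nat Hn); simpl INR in *.
    replace (0 / M) with 0 in S by (field; lra); lra.
  - rewrite sum_n_SR; specialize (IH ltac:(lia)); specialize (S (Datatypes.S n) Hn); lra. }
specialize (T N (Nat.le_refl N)); fold M in T.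
unfold mean; fold M.
replace (M / M) with 1 in T by (field; lra); exact T.
Qed.

Lemma is_RInt_plusR (f g : R -> R) (a b If Ig : R) :
  is_RInt f a b If -> is_RInt g a b Ig -> is_RInt (fun u => f u + g u) a b (If + Ig).
Proof. exact (@is_RInt_plus R_NormedModule f g a b If Ig). Qed.

Lemma is_RInt_minusR (f g : R -> R) (a b If Ig : R) :
  is_RInt f a b If -> is_RInt g a b Ig -> is_RInt (fun u => f u - g u) a b (If - Ig).
Proof. exact (@is_RInt_minus R_NormedModule f g a b If Ig). Qed.

Lemma is_RInt_scalR (f : R -> R) (a b c If : R) :
  is_RInt f a b If -> is_RInt (fun u => c * f u) a b (c * If).
Proof. exact (@is_RInt_scal R_NormedModule f a b c If). Qed.

Lemma is_RInt_ext_01 (f g : R -> R) (If : R) :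
  (forall u, 0 < u < 1 -> f u = g u) -> is_RInt f 0 1 If -> is_RInt g 0 1 If.
Proof.
intros H; apply is_RInt_ext; intros u; rewrite Rmin_left, Rmax_right by lra; apply H.
Qed.

Lemma is_RInt_sum_n (F : nat -> R -> R) (I : nat -> R) (a b : R) (n : nat) :
  (forall k, (k <= n)%nat -> is_RInt (F k) a b (I k)) ->
  is_RInt (fun u => sum_n (fun k => F k u) n) a b (sum_n I n).
Proof.
induction n as [|n IH]; intros H.
- rewrite sum_O; apply is_RInt_ext with (F 0%nat); [|apply H; lia].
  intros x _; now rewrite sum_O.
- rewrite sum_n_SR; apply is_RInt_ext with (fun u => sum_n (fun k => F k u) n + F (S n) u).
  + intros x _; now rewrite sum_n_SR.
  + apply is_RInt_plusR; [apply IH; intros k Hk|]; apply H; lia.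
Qed.

(** Plain linearity, taking the place of an interchange of two integrals. *)
Lemma is_RInt_mean (N : nat) (K : R -> R -> R) (I : R -> R) :
  (forall t, 0 < t <= 1 -> is_RInt (K t) 0 1 (I t)) ->
  is_RInt (fun u => mean N (fun t => K t u)) 0 1 (mean N I).
Proof.
intros H; unfold mean, Rdiv; rewrite Rmult_comm.
apply is_RInt_ext with
  (fun u => / INR (S N) * sum_n (fun j => K (INR (S j) / INR (S N)) u) N).
- intros x _; apply Rmult_comm.
- apply is_RInt_scalR, (is_RInt_sum_n (fun j => K (INR (S j) / INR (S N)))).
  intros j Hj; now apply H, grid_bounds.
Qed.

Lemma is_RInt_const_01 (c : R) : is_RInt (fun _ => c) 0 1 c.
Proof.
generalize (@is_RInt_const R_NormedModule 0 1 c).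
change (scal (1 - 0) c) with ((1 - 0) * c); now rewrite Rminus_0_r, Rmult_1_l.
Qed.

Lemma is_RInt_close (f g : R -> R) (If Ig e : R) :
  is_RInt f 0 1 If -> is_RInt g 0 1 Ig ->
  (forall u, 0 < u < 1 -> Rabs (f u - g u) <= e) -> Rabs (If - Ig) <= e.
Proof.
intros Hf Hg H.
assert (C := is_RInt_const_01).
assert (D : is_RInt (fun u => f u - g u) 0 1 (If - Ig)) by now apply is_RInt_minusR.
apply Rabs_le; split.
- apply (is_RInt_le (fun _ => - e) (fun u => f u - g u) 0 1); [lra|apply C|exact D|].
  intros u Hu; specialize (H u Hu); apply Rabs_le_between in H; lra.
- apply (is_RInt_le (fun u => f u - g u) (fun _ => e) 0 1); [lra|exact D|apply C|].
  intros u Hu; specialize (H u Hu); apply Rabs_le_between in H; lra.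
Qed.

(* Real powers with the convention that nonpositive numbers have power 0. For
   [a > 1] this is differentiable on the whole line, so that the fundamental
   theorem of calculus applies on [0, 1] with no boundary case. *)
Definition pw (x a : R) : R := if Rle_dec x 0 then 0 else exp (a * ln x).

Lemma pw_pos (x a : R) : 0 < x -> pw x a = exp (a * ln x).
Proof. intros H; unfold pw; destruct (Rle_dec x 0); [lra|reflexivity]. Qed.

Lemma pw_neg (x a : R) : x <= 0 -> pw x a = 0.
Proof. intros H; unfold pw; destruct (Rle_dec x 0); [reflexivity|lra]. Qed.

Lemma pw_ge0 (x a : R) : 0 <= pw x a.
Proof.
unfold pw; destruct (Rle_dec x 0); [lra|left; apply exp_pos].
Qed.

Lemma pw_1_l (a : R) : pw 1 a = 1.
Proof. rewrite pw_pos, ln_1, Rmult_0_r by lra; apply exp_0. Qed.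

Lemma pw_plus (x a b : R) : pw x (a + b) = pw x a * pw x b.
Proof.
unfold pw; destruct (Rle_dec x 0); [ring|].
rewrite <- exp_plus; f_equal; ring.
Qed.

Lemma pw_nat (x : R) (n : nat) : 0 < x -> pw x (INR n) = x ^ n.
Proof.
intros H; rewrite pw_pos by assumption; change (Rpower x (INR n) = x ^ n).
now apply Rpower_pow.
Qed.

Lemma pw_succ (x a : R) : 0 <= x -> pw x (a + 1) = pw x a * x.
Proof.
intros H; rewrite pw_plus; destruct (Rle_lt_or_eq_dec 0 x H) as [P| <-].
- f_equal; rewrite <- (pow_1 x) at 2; exact (pw_nat x 1 P).
- rewrite !(pw_neg 0) by lra; ring.
Qed.

Lemma exp_le (x y : R) : x <= y -> exp x <= exp y.
Proof. intros [H| ->]; [left; now apply exp_increasing|apply Rle_refl]. Qed.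

Lemma pw_le_1 (x a : R) : x <= 1 -> 0 <= a -> pw x a <= 1.
Proof.
intros Hx Ha; destruct (Rle_dec x 0).
- rewrite pw_neg; lra.
- rewrite pw_pos, <- exp_0 by lra; apply exp_le.
  assert (ln x <= 0) by (rewrite <- ln_1; apply ln_le; lra); nra.
Qed.

Lemma pw_small (a eps : R) : 0 < a -> 0 < eps ->
  exists d, 0 < d /\ forall x, x < d -> pw x a < eps.
Proof.
(* The threshold is eps^(1/a). *)
intros Ha He; exists (exp (ln eps / a)); split; [apply exp_pos|]; intros x Hx.
destruct (Rle_dec x 0); [now rewrite pw_neg|].
rewrite pw_pos by lra; rewrite <- (exp_ln eps He) at 1; apply exp_increasing.
rewrite Rmult_comm; apply Rlt_div_r; [lra|].
rewrite <- (ln_exp (ln eps / a)); apply ln_increasing; lra.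
Qed.

Lemma is_derive_pw_pos (x a : R) : 0 < x -> is_derive (fun y => pw y a) x (a * pw x (a - 1)).
Proof.
intros H; apply is_derive_ext_loc with (fun y => exp (a * ln y)).
- generalize (open_gt 0 x H); apply filter_imp; intros y Hy; now rewrite pw_pos.
- auto_derive; [exact H|].
  replace (pw x (a - 1)) with (pw x a * / x).
  + rewrite pw_pos by assumption; field; lra.
  + replace a with ((a - 1) + 1) at 1 by ring; rewrite pw_succ by lra; field; lra.
Qed.

Lemma is_derive_pw (x a : R) : 1 < a -> 0 <= x ->
  is_derive (fun y => pw y a) x (a * pw x (a - 1)).
Proof.
intros Ha Hx; destruct (Rle_lt_or_eq_dec 0 x Hx) as [P| <-]; [now apply is_derive_pw_pos|].
rewrite (pw_neg 0 (a - 1)) by lra; rewrite Rmult_0_r.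
apply is_derive_Reals; intros eps He.
destruct (pw_small (a - 1) eps) as [d [Hd Hs]]; [lra|assumption|].
exists (mkposreal d Hd); intros h Hh0 Hh; simpl in Hh.
rewrite Rplus_0_l, (pw_neg 0), !Rminus_0_r by lra.
destruct (Rle_dec h 0) as [N|P].
- rewrite pw_neg by assumption; unfold Rdiv; now rewrite Rmult_0_l, Rabs_R0.
(* For h > 0 the difference quotient at 0 is h^(a-1), small because a > 1. *)
- replace a with ((a - 1) + 1) by ring; rewrite pw_succ by lra.
  unfold Rdiv; rewrite Rmult_assoc, Rinv_r, Rmult_1_r, Rabs_pos_eq by (lra || apply pw_ge0).
  apply Hs; rewrite Rabs_pos_eq in Hh; lra.
Qed.

Lemma continuous_pw (x a : R) : 0 < a -> 0 <= x -> continuous (fun y => pw y a) x.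
Proof.
intros Ha Hx; destruct (Rle_lt_or_eq_dec 0 x Hx) as [P| <-].
- apply (ex_derive_continuous (fun y => pw y a)); eexists; now apply is_derive_pw_pos.
- apply filterlim_locally; intros eps.
  destruct (pw_small a eps Ha (cond_pos eps)) as [d [Hd Hs]].
  exists (mkposreal d Hd); intros y Hy; change (Rabs (y - 0) < d) in Hy.
  change (Rabs (pw y a - pw 0 a) < eps).
  rewrite (pw_neg 0), Rminus_0_r, Rabs_pos_eq by (lra || apply pw_ge0).
  apply Hs; generalize (Rle_abs (y - 0)); lra.
Qed.

Lemma is_RInt_pw (a : R) : 0 < a -> is_RInt (fun u => pw u a) 0 1 (1 / (a + 1)).
Proof.
intros Ha.
replace (1 / (a + 1)) with (minus (/ (a + 1) * pw 1 (a + 1)) (/ (a + 1) * pw 0 (a + 1))).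
- apply (is_RInt_derive (fun u => / (a + 1) * pw u (a + 1)));
    intros x; rewrite Rmin_left, Rmax_right by lra; intros Hx.
  + replace (pw x a) with (/ (a + 1) * ((a + 1) * pw x (a + 1 - 1))).
    * apply (is_derive_scal (fun u => pw u (a + 1)) x (/ (a + 1))), is_derive_pw; lra.
    * replace (a + 1 - 1) with a by ring; field; lra.
  + apply continuous_pw; lra.
- rewrite pw_1_l, (pw_neg 0) by lra; unfold minus, plus, opp; simpl; field; lra.
Qed.

Lemma is_RInt_pow_01 (s : nat) : is_RInt (fun u => u ^ s) 0 1 (1 / INR (S s)).
Proof.
generalize (is_RInt_pow 0 1 s); rewrite pow1, pow_i by lia.
replace (1 / INR (S s) - 0 / INR (S s)) with (1 / INR (S s)) by (unfold Rdiv; ring); easy.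
Qed.

(** * Moments of the logarithmic kernel *)

Definition log_kernel (u : R) : R := 1 / ln u + 1 / (1 - u).

Lemma ln_lt_0 (u : R) : 0 < u < 1 -> ln u < 0.
Proof. intros H; rewrite <- ln_1; apply ln_increasing; lra. Qed.

Lemma nonneg_of_antitone (F dF : R -> R) (u : R) : 0 < u < 1 -> F 1 = 0 ->
  (forall x, u <= x <= 1 -> is_derive F x (dF x)) ->
  (forall x, u <= x <= 1 -> dF x <= 0) -> 0 <= F u.
Proof.
intros Hu F1 HD Hd.
destruct (MVT_gen F u 1 dF) as [c [Hc Ec]]; rewrite ?Rmin_left, ?Rmax_right in * by lra.
- intros x Hx; apply HD; lra.
- intros x Hx; apply derivable_continuous_pt; exists (dF x); apply is_derive_Reals, HD; lra.
- specialize (Hd c Hc); nra.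
Qed.

(** Both differences vanish at 1 and have derivative minus a square over a positive quantity. The
    bounds agree to second order at 1, enough to find the limit of the kernel there. *)
Lemma ln_pade_bounds (u : R) : 0 < u < 1 ->
  (u - / u) / 2 <= ln u <= 2 * (u - 1) / (u + 1).
Proof.
intros Hu; split.
- apply Rminus_le_0.
  apply (nonneg_of_antitone (fun x => ln x - (x - / x) / 2)
    (fun x => - ((x - 1) ^ 2 / (2 * x ^ 2)))); [assumption|rewrite ln_1; field| |].
  + intros x Hx; auto_derive; [lra|field; lra].
  + intros x Hx; apply Ropp_le_cancel; rewrite Ropp_involutive, Ropp_0.
    apply Rdiv_le_0_compat; [apply pow2_ge_0|]. assert (0 < x ^ 2) by (apply pow_lt; lra); lra.
- apply Rminus_le_0.
  apply (nonneg_of_antitone (fun x => 2 * (x - 1) / (x + 1) - ln x)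
    (fun x => - ((x - 1) ^ 2 / (x * (x + 1) ^ 2)))); [assumption|rewrite ln_1; field| |].
  + intros x Hx; auto_derive; [lra|field; lra].
  + intros x Hx; apply Ropp_le_cancel; rewrite Ropp_involutive, Ropp_0.
    apply Rdiv_le_0_compat; [apply pow2_ge_0|].
    apply Rmult_lt_0_compat; [lra|apply pow_lt; lra].
Qed.

Lemma log_kernel_bounds (u : R) : 0 < u < 1 -> 1 / 2 <= log_kernel u <= 1 / (1 + u).
Proof.
intros Hu; destruct (ln_pade_bounds u Hu) as [H1 H2]; generalize (ln_lt_0 u Hu); intros H0.
set (L := - ln u); assert (HL : 0 < L) by (unfold L; lra).
assert (A : 2 * (1 - u) / (1 + u) <= L).
{ unfold L; replace (2 * (1 - u) / (1 + u)) with (- (2 * (u - 1) / (u + 1))) by (field; lra); lra. }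
assert (B : L <= (1 - u) * (1 + u) / (2 * u)).
{ unfold L; replace ((1 - u) * (1 + u) / (2 * u)) with (- ((u - / u) / 2)) by (field; lra); lra. }
unfold log_kernel; replace (1 / ln u) with (- / L) by (unfold L; field; lra).
assert (P : 0 < 2 * (1 - u) / (1 + u)) by (apply Rdiv_lt_0_compat; lra).
apply Rinv_le_contravar in A; [|assumption].
apply Rinv_le_contravar in B; [|assumption].
replace (/ (2 * (1 - u) / (1 + u))) with (1 / (1 - u) - 1 / 2) in A by (field; lra).
replace (/ ((1 - u) * (1 + u) / (2 * u))) with (1 / (1 - u) - 1 / (1 + u)) in B by (field; lra).
lra.
Qed.

(** The continuous extension by the limits 1 at 0 and 1/2 at 1, constant outside, so that continuity
    at the endpoints is two-sided. *)
Definition log_kernel_ext (u : R) : R :=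
  if Rle_dec u 0 then 1 else if Rlt_dec u 1 then log_kernel u else 1 / 2.

Lemma log_kernel_ext_eq (u : R) : 0 < u < 1 -> log_kernel_ext u = log_kernel u.
Proof.
intros H; unfold log_kernel_ext; destruct (Rle_dec u 0); [lra|].
destruct (Rlt_dec u 1); [reflexivity|lra].
Qed.

Lemma continuous_log_kernel_ext (u : R) : 0 <= u <= 1 -> continuous log_kernel_ext u.
Proof.
intros [[H0| <-] H1]; [destruct H1 as [H1| ->]|].
- apply continuous_ext_loc with log_kernel.
  + generalize (open_and _ _ (open_gt 0) (open_lt 1) u (conj H0 H1)); apply filter_imp.
    intros y Hy; now rewrite log_kernel_ext_eq.
  + apply (ex_derive_continuous log_kernel); unfold log_kernel.
    generalize (ln_lt_0 u (conj H0 H1)); intros; auto_derive; repeat split; lra.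
- apply filterlim_locally; intros eps.
  (* The extension differs from 1/2 by at most |y - 1|, so eps is its own modulus. *)
  exists eps; intros y Hy; change (Rabs (y - 1) < eps) in Hy.
  change (Rabs (log_kernel_ext y - log_kernel_ext 1) < eps).
  unfold log_kernel_ext at 2; destruct (Rle_dec 1 0); [lra|]; destruct (Rlt_dec 1 1); [lra|].
  unfold log_kernel_ext; destruct (Rle_dec y 0) as [Hy0|Hy0].
  + rewrite Rabs_left1 in Hy by lra; rewrite Rabs_pos_eq; lra.
  + destruct (Rlt_dec y 1); [|rewrite Rminus_diag, Rabs_R0; apply cond_pos].
    destruct (log_kernel_bounds y ltac:(lra)) as [A B].
    rewrite Rabs_left1 in Hy by lra; rewrite Rabs_pos_eq by lra.
    apply Rle_lt_trans with (1 / (1 + y) - 1 / 2); [lra|].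
    apply Rle_lt_trans with (1 - y); [|lra].
    replace (1 / (1 + y) - 1 / 2) with ((1 - y) * / (2 * (1 + y))) by (field; lra).
    rewrite <- (Rmult_1_r (1 - y)) at 2; apply Rmult_le_compat_l; [lra|].
    rewrite <- Rinv_1; apply Rinv_le_contravar; lra.
- apply filterlim_locally; intros eps.
  (* Below exp(-1/eps) the term 1/ln y exceeds -eps, while 1/(1-y) >= 1 and the kernel is at most
     1. *)
  assert (Hd : 0 < Rmin 1 (exp (- / eps))) by (apply Rmin_pos; [lra|apply exp_pos]).
  exists (mkposreal _ Hd); intros y Hy; change (Rabs (y - 0) < Rmin 1 (exp (- / eps))) in Hy.
  change (Rabs (log_kernel_ext y - log_kernel_ext 0) < eps).
  unfold log_kernel_ext at 2; destruct (Rle_dec 0 0); [|lra].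
  unfold log_kernel_ext; destruct (Rle_dec y 0) as [Hy0|Hy0].
  { rewrite Rminus_diag, Rabs_R0; apply cond_pos. }
  rewrite Rminus_0_r, Rabs_pos_eq in Hy by lra.
  generalize (Rmin_l 1 (exp (- / eps))) (Rmin_r 1 (exp (- / eps))); intros M1 M2.
  destruct (Rlt_dec y 1); [|lra].
  destruct (log_kernel_bounds y ltac:(lra)) as [A B].
  assert (1 / (1 + y) <= 1) by (apply Rle_div_l; lra).
  rewrite Rabs_left1 by lra.
  assert (C : ln y < - / eps) by (rewrite <- (ln_exp (- / eps)); apply ln_increasing; lra).
  assert (D : 1 <= 1 / (1 - y)) by (apply Rle_div_r; lra).
  assert (E : / - ln y < eps).
  { assert (Pe := cond_pos eps); rewrite <- (Rinv_inv eps); apply Rinv_lt_contravar; [|lra].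
    apply Rmult_lt_0_compat; [now apply Rinv_0_lt_compat|].
    generalize (Rinv_0_lt_compat _ Pe); lra. }
  assert (N : ln y < 0) by (apply ln_lt_0; lra).
  unfold log_kernel; replace (1 / ln y) with (- / - ln y) by (field; lra); lra.
Qed.

Lemma ex_RInt_mul_log_kernel (p : R -> R) :
  (forall u, 0 <= u <= 1 -> continuous p u) -> ex_RInt (fun u => p u * log_kernel u) 0 1.
Proof.
intros Hp; apply ex_RInt_ext with (fun u => p u * log_kernel_ext u).
- intros u; rewrite Rmin_left, Rmax_right by lra; intros Hu; now rewrite log_kernel_ext_eq.
- apply (ex_RInt_continuous (V := R_CompleteNormedModule)).
  intros u; rewrite Rmin_left, Rmax_right by lra; intros Hu.
  apply (continuous_mult p log_kernel_ext); [now apply Hp|now apply continuous_log_kernel_ext].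
Qed.

Lemma continuous_pow (s : nat) (u : R) : continuous (fun x : R => x ^ s) u.
Proof. apply (ex_derive_continuous (fun x : R => x ^ s)); auto_derive; exact I. Qed.

Definition log_moment (s : nat) : R := RInt (fun u => u ^ s * log_kernel u) 0 1.

Lemma is_RInt_log_moment (s : nat) :
  is_RInt (fun u => u ^ s * log_kernel u) 0 1 (log_moment s).
Proof.
apply (RInt_correct (V := R_CompleteNormedModule)), ex_RInt_mul_log_kernel.
intros u _; apply continuous_pow.
Qed.

Lemma log_moment_bounds (s : nat) : 0 <= log_moment s <= 1 / INR (S s).
Proof.
split.
- apply (is_RInt_le (fun _ => 0) (fun u => u ^ s * log_kernel u) 0 1).
  + lra.
  + apply is_RInt_const_01.
  + apply is_RInt_log_moment.
  + intros u Hu; apply Rmult_le_pos; [apply pow_le; lra|].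
    destruct (log_kernel_bounds u Hu); lra.
- apply (is_RInt_le (fun u => u ^ s * log_kernel u) (fun u => u ^ s) 0 1);
    [lra|apply is_RInt_log_moment|apply is_RInt_pow_01|].
  intros u Hu; rewrite <- (Rmult_1_r (u ^ s)) at 2.
  apply Rmult_le_compat_l; [apply pow_le; lra|].
  destruct (log_kernel_bounds u Hu) as [_ B].
  apply Rle_trans with (1 := B), Rle_div_l; lra.
Qed.

(** The function approximated is the integral of u^(s+t) over t in [0,1], and the integrand
    decreases in t. *)
Lemma pow_log_mean (s N : nat) (u : R) : 0 < u < 1 ->
  Rabs (u ^ s * ((u - 1) / ln u) - mean N (fun t => pw u (INR s + t))) <= 1 / INR (S N).
Proof.
intros Hu; generalize (ln_lt_0 u Hu); intros L.
destruct (mean_antitone_bounds (fun t => pw u (INR s + t) / ln u) (fun t => pw u (INR s + t)) N)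
  as [A B].
- intros t _; apply is_derive_ext with (fun t => exp ((INR s + t) * ln u) / ln u).
  + intros y; now rewrite pw_pos.
  + rewrite pw_pos by lra; auto_derive; [lra|field; lra].
- intros x y H0 Hxy H1; rewrite !pw_pos by lra; apply exp_le; nra.
- assert (E : pw u (INR s + 1) / ln u - pw u (INR s + 0) / ln u = u ^ s * ((u - 1) / ln u)).
  { rewrite pw_succ, Rplus_0_r, pw_nat by lra; field; lra. }
  rewrite E in A, B.
  rewrite Rabs_pos_eq by assumption; apply Rle_trans with (1 := B).
  apply Rmult_le_compat_r; [left; apply Rinv_0_lt_compat, lt_0_INR; lia|].
  generalize (pw_le_1 u (INR s + 0) ltac:(lra) ltac:(generalize (pos_INR s); lra))
    (pw_ge0 u (INR s + 1)); lra.
Qed.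

Lemma ln_ratio_mean (s N : nat) :
  Rabs (ln (INR (S (S s)) / INR (S s)) - mean N (fun t => 1 / (INR s + t + 1))) <= 1 / INR (S N).
Proof.
assert (P := pos_INR s).
destruct (mean_antitone_bounds (fun t => ln (INR s + t + 1)) (fun t => 1 / (INR s + t + 1)) N)
  as [A B].
- intros x Hx; auto_derive; [lra|field; lra].
- intros x y H0 Hxy H1; apply Rmult_le_compat_l; [lra|]; apply Rinv_le_contravar; lra.
- rewrite <- ln_div, Rplus_0_r in A, B by lra.
  rewrite (S_INR (S s)), (S_INR s), Rabs_pos_eq by assumption; apply Rle_trans with (1 := B).
  apply Rmult_le_compat_r; [left; apply Rinv_0_lt_compat, lt_0_INR; lia|].
  assert (1 / (INR s + 1) <= 1) by (apply Rle_div_l; lra).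
  assert (0 <= 1 / (INR s + 1 + 1)) by (apply Rdiv_le_0_compat; lra); lra.
Qed.

Lemma eq_eps_harmonic (x y C : R) :
  (forall N, Rabs (x - y) <= C / INR (S N)) -> x = y.
Proof.
intros H; apply Rle_antisym; apply le_eps_harmonic with C; intros N;
  specialize (H N); apply Rabs_le_between in H; lra.
Qed.

(** The difference of integrands is u^s - u^s (u-1)/ln u. Replacing the last term by a mean of
    powers u^(s+t), integrating each in u, and recognizing the mean of 1/(s+t+1) as a logarithm
    costs an error of order 1/(N+1). *)
Lemma log_moment_succ (s : nat) :
  log_moment s - log_moment (S s) = 1 / INR (S s) - ln (INR (S (S s)) / INR (S s)).
Proof.
apply eq_eps_harmonic with 2; intros N.
assert (D : Rabs (log_moment s - log_moment (S s)
   - (1 / INR (S s) - mean N (fun t => 1 / (INR s + t + 1)))) <= 1 / INR (S N)).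
{ apply (is_RInt_close (fun u => u ^ s * log_kernel u - u ^ S s * log_kernel u)
    (fun u => u ^ s - mean N (fun t => pw u (INR s + t)))).
  - apply is_RInt_minusR; apply is_RInt_log_moment.
  - apply is_RInt_minusR; [apply is_RInt_pow_01|].
    apply (is_RInt_mean N (fun t u => pw u (INR s + t))); intros t Ht.
    apply is_RInt_pw; generalize (pos_INR s); lra.
  - intros u Hu; rewrite <- Rabs_Ropp.
    replace (- _) with (u ^ s * ((u - 1) / ln u) - mean N (fun t => pw u (INR s + t))).
    + now apply pow_log_mean.
    + unfold log_kernel; generalize (ln_lt_0 u Hu); intros; simpl pow; field; lra. }
generalize (ln_ratio_mean s N); intros E.
assert (X : 2 / INR (S N) = 1 / INR (S N) + 1 / INR (S N)) by (unfold Rdiv; ring).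
apply Rabs_le_between in D; apply Rabs_le_between in E; apply Rabs_le; lra.
Qed.

Lemma log_moment_telescope (s : nat) :
  log_moment s = ln (INR (S s)) + log_moment 0 - harmonic s.
Proof.
induction s as [|s IH].
- unfold harmonic; rewrite sum_n_m_zero by lia; change (INR 1) with 1; rewrite ln_1.
  change (zero : R) with 0; ring.
- generalize (log_moment_succ s); rewrite harmonic_succ, ln_div, IH by (apply lt_0_INR; lia).
  lra.
Qed.

(** By the telescoped formula, [log_moment 0] is the harmonic number minus a logarithm, up to a
    moment that tends to 0. *)
Lemma euler_gamma_log_moment : euler_gamma = log_moment 0.
Proof.
unfold euler_gamma.
replace (Lim_seq _) with (Finite (log_moment 0)); [reflexivity|].
(* Starting at index 1 avoids the conventional value of the logarithm at 0. *)
symmetry; apply is_lim_seq_unique, is_lim_seq_incr_1.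
apply is_lim_seq_le_le with (fun n => log_moment 0 - / INR (S n)) (fun n => log_moment 0 + / INR (S n)).
- intros n; change (sum_n_m (fun k => 1 / INR k) 1 (S n)) with (harmonic (S n)).
  generalize (log_moment_telescope (S n)) (log_moment_bounds (S n)).
  assert (P : 0 < INR (S n)) by (apply lt_0_INR; lia).
  assert (A : ln (INR (S (S n))) - ln (INR (S n)) <= / INR (S n)).
  { rewrite <- ln_div by (apply lt_0_INR; lia).
    rewrite <- (ln_exp (/ INR (S n))); apply ln_le.
    - apply Rdiv_lt_0_compat; apply lt_0_INR; lia.
    - apply Rle_trans with (2 := exp_ineq1_le _); rewrite (S_INR (S n)); right; field; lra. }
  assert (B : ln (INR (S n)) <= ln (INR (S (S n)))) by (apply ln_le; [exact P|apply le_INR; lia]).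
  assert (C : 1 / INR (S (S n)) <= / INR (S n)).
  { unfold Rdiv; rewrite Rmult_1_l; apply Rinv_le_contravar; [exact P|apply le_INR; lia]. }
  lra.
- replace (Finite (log_moment 0)) with (Finite (log_moment 0 - 0)) by (f_equal; ring).
  apply is_lim_seq_minus'; [apply is_lim_seq_const|].
  apply (is_lim_seq_incr_1 (fun n => / INR n)).
  apply (is_lim_seq_inv INR p_infty); [apply is_lim_seq_INR|easy].
- replace (Finite (log_moment 0)) with (Finite (log_moment 0 + 0)) by (f_equal; ring).
  apply is_lim_seq_plus'; [apply is_lim_seq_const|].
  apply (is_lim_seq_incr_1 (fun n => / INR n)).
  apply (is_lim_seq_inv INR p_infty); [apply is_lim_seq_INR|easy].
Qed.

Lemma log_moment_eq (s : nat) :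
  log_moment s = ln (INR (S s)) + euler_gamma - harmonic s.
Proof. rewrite euler_gamma_log_moment; apply log_moment_telescope. Qed.

Lemma legendre_integral_moments (n m : nat) :
  legendre_integral n m = sum_n (fun k => legendre_coef n k * log_moment (k + (n - m))) n.
Proof.
apply is_RInt_unique.
apply is_RInt_ext_01 with
  (fun u => sum_n (fun k => legendre_coef n k * (u ^ (k + (n - m)) * log_kernel u)) n).
- intros u _; change (1 / ln u + 1 / (1 - u)) with (log_kernel u).
  unfold shifted_legendre; rewrite Rmult_assoc, (Rmult_comm (sum_n _ _)), <- Rmult_assoc, <- sum_n_scalR.
  apply sum_n_extR; intros k _; rewrite pow_add; ring.
- apply (is_RInt_sum_n (fun k u => legendre_coef n k * (u ^ (k + (n - m)) * log_kernel u))).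
  intros k _; apply is_RInt_scalR, is_RInt_log_moment.
Qed.

Lemma legendre_integral_eq (n m : nat) :
  legendre_integral n m = legendre_log n m + euler_gamma
    - sum_n (fun k => legendre_coef n k * harmonic (k + (n - m))) n.
Proof.
rewrite legendre_integral_moments; unfold legendre_log.
transitivity (sum_n (fun k => legendre_coef n k * ln (INR (n - m + k + 1))) n
  + euler_gamma * sum_n (legendre_coef n) n
  + -1 * sum_n (fun k => legendre_coef n k * harmonic (k + (n - m))) n).
- rewrite <- !sum_n_scalR, <- !sum_n_plusR; apply sum_n_extR; intros k _.
  rewrite log_moment_eq; replace (n - m + k + 1)%nat with (S (k + (n - m))) by lia; ring.
- rewrite legendre_coef_sum; ring.
Qed.

(** * Integration by parts *)

(* [rodrigues n k] is u^(k+1) times the k-th derivative of u^k (1 - u)^n; these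
   polynomials are obtained from u (1 - u)^n by iterating p |-> u^2 p'. *)
Definition rising (i k : nat) : R := lin_prod (map INR (seq 1 k)) (INR i).

Definition rodrigues (n k : nat) (u : R) : R :=
  sum_n (fun i => (-1) ^ i * Binomial.C n i * rising i k * u ^ (i + k + 1)) n.

Definition rodrigues_deriv (n k : nat) (u : R) : R :=
  sum_n (fun i => (-1) ^ i * Binomial.C n i * rising i (S k) * u ^ (i + k)) n.

Lemma rising_succ (i k : nat) : rising i (S k) = INR (i + k + 1) * rising i k.
Proof.
apply Rmult_eq_reg_r with (INR (fact i)); [|apply INR_fact_neq_0].
rewrite Rmult_assoc; unfold rising; rewrite !lin_prod_seq.
replace (i + S k)%nat with (S (i + k)) by lia; rewrite Nat.add_1_r.
now rewrite fact_simpl, mult_INR.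
Qed.

Lemma is_derive_sum_nR (f : nat -> R -> R) (df : nat -> R) (u : R) (n : nat) :
  (forall k, is_derive (f k) u (df k)) ->
  is_derive (fun x => sum_n (fun k => f k x) n) u (sum_n df n).
Proof.
intros H; apply (is_derive_sum_n f n u df); auto.
Qed.

Lemma is_derive_rodrigues (n k : nat) (u : R) :
  is_derive (rodrigues n k) u (rodrigues_deriv n k u).
Proof.
apply (is_derive_sum_nR (fun i x => (-1) ^ i * Binomial.C n i * rising i k * x ^ (i + k + 1))).
intros i; rewrite rising_succ, Nat.add_1_r.
auto_derive; [exact I|].
change (match (i + k)%nat with 0%nat => 1 | S _ => INR (i + k) + 1 end) with (INR (S (i + k))); ring.
Qed.

Lemma rodrigues_step (n k : nat) (u : R) :
  rodrigues n (S k) u = u ^ 2 * rodrigues_deriv n k u.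
Proof.
unfold rodrigues, rodrigues_deriv; rewrite <- sum_n_scalR; apply sum_n_extR; intros i _.
replace (i + S k + 1)%nat with (2 + (i + k))%nat by lia; rewrite pow_add; ring.
Qed.

Lemma rodrigues_0_r (n k : nat) : rodrigues n k 0 = 0.
Proof.
transitivity (0 * sum_n (fun _ => 0) n); [|apply Rmult_0_l].
unfold rodrigues; rewrite <- sum_n_scalR; apply sum_n_extR; intros i _; rewrite (pow_i (i + k + 1)) by lia; ring.
Qed.

(** Fewer than n derivatives leave a zero at 1; as a sum, it is an n-th difference of a polynomial
    of degree k. *)
Lemma rodrigues_1_r (n k : nat) : (k < n)%nat -> rodrigues n k 1 = 0.
Proof.
intros H; transitivity (alt_binom_sum n (fun i => lin_prod (map INR (seq 1 k)) (INR i))).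
- apply sum_n_extR; intros i _; rewrite pow1; apply Rmult_1_r.
- rewrite alt_binom_sum_lin_prod; rewrite length_map, length_seq; [|lia].
  now replace (k =? n)%nat with false by (symmetry; apply Nat.eqb_neq; lia).
Qed.

Lemma rodrigues_0_l (n : nat) (u : R) : rodrigues n 0 u = u * (1 - u) ^ n.
Proof.
replace (1 - u) with (- u + 1) by ring.
rewrite binomial, <- sum_n_Reals, <- sum_n_scalR; apply sum_n_extR; intros i _.
replace (- u) with (-1 * u) by ring.
rewrite Rpow_mult_distr, pow1; unfold rising; simpl lin_prod.
replace (i + 0 + 1)%nat with (S i) by lia; simpl pow; ring.
Qed.

(** Rodrigues' formula for n = p + 1, multiplied by u^p. *)
Lemma rodrigues_deriv_legendre (p : nat) (u : R) :
  rodrigues_deriv (S p) p u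
  = INR (fact (S p)) * (-1) ^ S p * (u ^ p * shifted_legendre (S p) u).
Proof.
unfold rodrigues_deriv, shifted_legendre; rewrite <- !sum_n_scalR.
apply sum_n_extR; intros i _; unfold legendre_coef; rewrite binom_lin_prod, !pow_add.
fold (rising i (S p)).
transitivity ((-1) ^ S p * (-1) ^ S p * ((-1) ^ i * Binomial.C (S p) i * rising i (S p) * (u ^ i * u ^ p))).
- rewrite sign_sq; ring.
- field; apply INR_fact_neq_0.
Qed.

Definition den (th u : R) : R := th + (1 - th) * u.

Lemma den_pos (th u : R) : 0 < th <= 1 -> 0 <= u -> 0 < den th u.
Proof. intros; unfold den; nra. Qed.

(** Powers of the map z = u / [den th u], which for 0 < th <= 1 fixes 0 and 1 and has derivative th
    / den^2. That denominator pairs with the factor u^2 in [rodrigues_step] to give z^2. *)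
Definition mobius_pw (th b u : R) : R := pw (u / den th u) b.

Lemma mobius_ge0 (th u : R) : 0 < th <= 1 -> 0 <= u -> 0 <= u / den th u.
Proof. intros; apply Rdiv_le_0_compat; [assumption|now apply den_pos]. Qed.

Lemma mobius_pw_succ (th b u : R) : 0 < th <= 1 -> 0 <= u ->
  mobius_pw th (b + 1) u = mobius_pw th b u * (u / den th u).
Proof. intros; now apply pw_succ, mobius_ge0. Qed.

Lemma continuous_mobius_pw (th b u : R) : 0 < th <= 1 -> 0 <= u -> 0 < b ->
  continuous (mobius_pw th b) u.
Proof.
intros Ht Hu Hb; generalize (den_pos th u Ht Hu); intros D.
apply (continuous_comp (fun u => u / den th u) (fun y => pw y b)).
- apply (ex_derive_continuous (fun u => u / den th u)); unfold den in *; auto_derive; lra.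
- now apply continuous_pw; [|apply mobius_ge0].
Qed.

Lemma is_derive_mobius_pw (th b u : R) : 0 < th <= 1 -> 0 <= u -> 1 < b ->
  is_derive (mobius_pw th b) u (b * th * (mobius_pw th (b - 1) u / den th u ^ 2)).
Proof.
intros Ht Hu Hb; generalize (den_pos th u Ht Hu); intros D.
replace (b * th * _) with (th / den th u ^ 2 * (b * pw (u / den th u) (b - 1)))
  by (unfold mobius_pw; field; lra).
apply (is_derive_comp (fun y => pw y b) (fun u => u / den th u)).
- apply is_derive_pw; [assumption|now apply mobius_ge0].
- unfold den in *; auto_derive; [lra|field; lra].
Qed.

Lemma continuous_rodrigues (n k : nat) (u : R) : continuous (rodrigues n k) u.
Proof. apply (ex_derive_continuous (rodrigues n k)); eexists; apply is_derive_rodrigues. Qed.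

Lemma continuous_rodrigues_deriv (n k : nat) (u : R) : continuous (rodrigues_deriv n k) u.
Proof.
apply (ex_derive_continuous (rodrigues_deriv n k)); eexists.
apply (is_derive_sum_nR (fun i x => (-1) ^ i * Binomial.C n i * rising i (S k) * x ^ (i + k))).
intros i; auto_derive; [exact I|reflexivity].
Qed.

Lemma continuous_inv_den (th u : R) (m : nat) : 0 < th <= 1 -> 0 <= u ->
  continuous (fun u => / den th u ^ m) u.
Proof.
intros Ht Hu; generalize (den_pos th u Ht Hu); intros D.
apply (ex_derive_continuous (fun u => / den th u ^ m)); unfold den in *; auto_derive.
apply pow_nonzero; lra.
Qed.

(** The product of the two factors vanishes at both endpoints, so its derivative has integral 0. *)
Lemma rodrigues_by_parts (n k : nat) (th b I : R) : (k < n)%nat -> 0 < th <= 1 -> 1 < b ->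
  is_RInt (fun u => rodrigues n k u * (mobius_pw th (b - 1) u / den th u ^ 2)) 0 1 I ->
  is_RInt (fun u => rodrigues_deriv n k u * mobius_pw th b u) 0 1 (- th * b * I).
Proof.
intros Hk Ht Hb HI.
set (h := fun u => rodrigues n k u * (mobius_pw th (b - 1) u / den th u ^ 2)) in *.
assert (D : is_RInt (fun u => rodrigues_deriv n k u * mobius_pw th b u + b * th * h u) 0 1 0).
{ replace 0 with (minus (rodrigues n k 1 * mobius_pw th b 1) (rodrigues n k 0 * mobius_pw th b 0)) at 2.
  - apply (is_RInt_derive (fun u => rodrigues n k u * mobius_pw th b u));
      intros u; rewrite Rmin_left, Rmax_right by lra; intros Hu.
    + replace (_ + _) with (rodrigues_deriv n k u * mobius_pw th b u
        + rodrigues n k u * (b * th * (mobius_pw th (b - 1) u / den th u ^ 2))) by (unfold h; ring).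
      apply (is_derive_mult (rodrigues n k) (mobius_pw th b) u);
        [apply is_derive_rodrigues|apply is_derive_mobius_pw; lra|intros; apply Rmult_comm].
    + apply (continuous_plus (fun u => rodrigues_deriv n k u * mobius_pw th b u)
        (fun u => b * th * h u)).
      * apply (continuous_mult (rodrigues_deriv n k) (mobius_pw th b));
          [apply continuous_rodrigues_deriv|apply continuous_mobius_pw; lra].
      * apply (continuous_mult (fun _ => b * th) h); [apply continuous_const|].
        apply (continuous_mult (rodrigues n k)); [apply continuous_rodrigues|].
        apply (continuous_mult (mobius_pw th (b - 1)) (fun u => / den th u ^ 2));
          [apply continuous_mobius_pw; lra|apply continuous_inv_den; lra].
  - rewrite rodrigues_1_r, rodrigues_0_r, !Rmult_0_l by assumption.
    unfold minus, plus, opp; simpl; ring. }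
generalize (is_RInt_minusR _ _ _ _ _ _ D (is_RInt_scalR _ _ _ (b * th) _ HI)).
replace (0 - b * th * I) with (- th * b * I) by ring.
apply is_RInt_ext_01; intros u _; unfold h; ring.
Qed.

Fixpoint poch (x : R) (k : nat) : R :=
  match k with 0%nat => 1 | S k => x * poch (x + 1) k end.

(** For th = 1 this is Euler's beta integral B(b+1, n+1). *)
Definition beta_int (n : nat) (th b : R) : R :=
  RInt (fun u => (1 - u) ^ n * (mobius_pw th b u / den th u)) 0 1.

Lemma is_RInt_beta_int (n : nat) (th b : R) : 0 < th <= 1 -> 0 < b ->
  is_RInt (fun u => (1 - u) ^ n * (mobius_pw th b u / den th u)) 0 1 (beta_int n th b).
Proof.
intros Ht Hb; apply (RInt_correct (V := R_CompleteNormedModule)).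
apply (ex_RInt_continuous (V := R_CompleteNormedModule)).
intros u; rewrite Rmin_left, Rmax_right by lra; intros Hu.
apply (continuous_mult (fun u => (1 - u) ^ n)).
- apply (ex_derive_continuous (fun u => (1 - u) ^ n)); auto_derive; exact I.
- apply (continuous_mult (mobius_pw th b) (fun u => / den th u));
    [apply continuous_mobius_pw; lra|].
  apply continuous_ext with (fun u => / den th u ^ 1);
    [intros; f_equal; apply pow_1|apply continuous_inv_den; lra].
Qed.

(** Each integration by parts lowers the exponent to b - 1, and u^2 / den^2 raises it to b + 1; the
    factors b, b+1, ... accumulate into [poch]. *)
Lemma is_RInt_rodrigues_deriv (n k : nat) (th b : R) : (k < n)%nat -> 0 < th <= 1 -> 1 < b ->
  is_RInt (fun u => rodrigues_deriv n k u * mobius_pw th b u) 0 1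
    ((- th) ^ S k * poch b (S k) * beta_int n th (b + INR k)).
Proof.
intros Hk Ht; revert b Hk; induction k as [|k IH]; intros b Hk Hb.
- replace (_ * _) with (- th * b * beta_int n th (b + INR 0)) by (simpl; ring).
  apply rodrigues_by_parts; try assumption.
  simpl INR; rewrite Rplus_0_r.
  apply is_RInt_ext_01 with (2 := is_RInt_beta_int n th b Ht ltac:(lra)).
  intros u Hu; rewrite rodrigues_0_l; replace b with (b - 1 + 1) at 1 by ring.
  rewrite mobius_pw_succ by lra; generalize (den_pos th u Ht ltac:(lra)); intros.
  field; lra.
- replace (_ * _) with (- th * b * ((- th) ^ S k * poch (b + 1) (S k) * beta_int n th (b + 1 + INR k))).
  + apply rodrigues_by_parts; try assumption.
    apply is_RInt_ext_01 with (2 := IH (b + 1) ltac:(lia) ltac:(lra)).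
    intros u Hu; rewrite rodrigues_step; replace (b + 1) with (b - 1 + 1 + 1) by ring.
    rewrite !mobius_pw_succ by lra; generalize (den_pos th u Ht ltac:(lra)); intros.
    field; lra.
  + rewrite (S_INR k); replace (b + (INR k + 1)) with (b + 1 + INR k) by ring.
    change (poch b (S (S k))) with (b * poch (b + 1) (S k)); simpl pow; ring.
Qed.

Lemma poch_le (k : nat) (x y : R) : 0 <= x <= y -> 0 <= poch x k <= poch y k.
Proof.
revert x y; induction k as [|k IH]; intros x y H; simpl; [lra|].
specialize (IH (x + 1) (y + 1) ltac:(lra)).
split; [apply Rmult_le_pos; lra|apply Rmult_le_compat; lra].
Qed.

Lemma poch_fact (k m : nat) : poch (INR m + 1) k * INR (fact m) = INR (fact (m + k)).
Proof.
revert m; induction k as [|k IH]; intros m; [simpl; rewrite Nat.add_0_r; ring|].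
replace (m + S k)%nat with (S m + k)%nat by lia; rewrite <- IH, fact_simpl, mult_INR.
change (poch (INR m + 1) (S k)) with ((INR m + 1) * poch (INR m + 1 + 1) k).
rewrite S_INR; ring.
Qed.

(** With z = u/den, the integrand contains (th z (1-u))^p, and th <= den gives th z <= u, hence the
    bound u(1-u) <= 1/4. The remaining factors lie in [0,1]. *)
Lemma beta_int_bounds (p : nat) (th b : R) : 0 < th <= 1 -> 0 < b ->
  0 <= th ^ S p * beta_int (S p) th (b + INR (S p)) <= / 4 ^ p.
Proof.
intros Ht Hb; assert (Pn := pos_INR (S p)).
assert (HI := is_RInt_scalR _ _ _ (th ^ S p) _
  (is_RInt_beta_int (S p) th (b + INR (S p)) Ht ltac:(lra))).
assert (B : forall u, 0 < u < 1 ->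
  0 <= th ^ S p * ((1 - u) ^ S p * (mobius_pw th (b + INR (S p)) u / den th u)) <= / 4 ^ p).
{ intros u Hu; assert (D := den_pos th u Ht ltac:(lra)).
  set (z := u / den th u).
  assert (Hz : 0 < z) by (apply Rdiv_lt_0_compat; lra).
  assert (z1 : z <= 1) by (apply Rle_div_l; [exact D|]; unfold den; nra).
  assert (tz : th * z <= u).
  { unfold z; replace (th * (u / den th u)) with (u * th / den th u) by (field; lra).
    apply Rle_div_l; [exact D|]; apply Rmult_le_compat_l; [lra|]; unfold den; nra. }
  unfold mobius_pw; fold z; rewrite pw_plus, pw_nat by assumption.
  replace (_ * _) with ((th * z * (1 - u)) ^ p * ((1 - u) * z * (th / den th u) * pw z b))
    by (simpl pow; rewrite !Rpow_mult_distr; field; lra).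
  assert (A : 0 <= th * z * (1 - u) <= / 4).
  { split; [apply Rmult_le_pos; [apply Rmult_le_pos|]; lra|].
    apply Rle_trans with (u * (1 - u)); [apply Rmult_le_compat_r; lra|].
    generalize (pow2_ge_0 (u - / 2)); simpl; lra. }
  assert (td : 0 <= th / den th u <= 1).
  { split; [apply Rdiv_le_0_compat; lra|]; apply Rle_div_l; [exact D|]; unfold den; nra. }
  assert (q := pw_ge0 z b); assert (q1 := pw_le_1 z b z1 ltac:(lra)).
  assert (A2 : 0 <= (1 - u) * z <= 1) by (split; [apply Rmult_le_pos|]; nra).
  assert (A3 : 0 <= (1 - u) * z * (th / den th u) <= 1) by (split; [apply Rmult_le_pos|]; nra).
  assert (A4 : 0 <= (1 - u) * z * (th / den th u) * pw z b <= 1) by (split; [apply Rmult_le_pos|]; nra).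
  split; [apply Rmult_le_pos; [apply pow_le|]; lra|].
  rewrite <- (Rmult_1_r (/ 4 ^ p)), <- pow_inv.
  apply Rmult_le_compat; [apply pow_le; lra|lra|apply pow_incr; lra|lra]. }
split.
- apply (is_RInt_le (fun _ => 0) _ 0 1 _ _ ltac:(lra)) with (2 := HI); [|intros u Hu; now apply B].
  apply is_RInt_const_01.
- apply (is_RInt_le _ (fun _ => / 4 ^ p) 0 1 _ _ ltac:(lra) HI); [|intros u Hu; now apply B].
  apply is_RInt_const_01.
Qed.

(** * The kernel as an average *)

Definition kernel (t th u : R) : R := t * (mobius_pw th t u / den th u).

Definition kernel_moment (p : nat) (t th : R) : R :=
  t * poch (t + 1) (S p) / INR (fact (S p)) * (th ^ S p * beta_int (S p) th (t + INR (S p))).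

Lemma is_RInt_kernel_moment (p : nat) (t th : R) : 0 < t <= 1 -> 0 < th <= 1 ->
  is_RInt (fun u => u ^ S p * shifted_legendre (S p) u * kernel t th u) 0 1 (kernel_moment p t th).
Proof.
intros Ht Hth.
(* The exponent used is t + 1: its extra factor u/den turns u^p into u^(p+1) and supplies the
   denominator of the kernel. *)
replace (kernel_moment p t th) with (t * (-1) ^ S p / INR (fact (S p)) *
  ((- th) ^ S p * poch (t + 1) (S p) * beta_int (S p) th (t + 1 + INR p))).
- apply is_RInt_ext_01 with (2 := is_RInt_scalR _ _ _ (t * (-1) ^ S p / INR (fact (S p))) _
    (is_RInt_rodrigues_deriv (S p) p th (t + 1) ltac:(lia) Hth ltac:(lra))); intros u Hu.
  rewrite rodrigues_deriv_legendre, mobius_pw_succ by lra; unfold kernel.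
  transitivity ((-1) ^ S p * (-1) ^ S p * (u ^ S p * shifted_legendre (S p) u *
    (t * (mobius_pw th t u / den th u)))); [|rewrite sign_sq; ring].
  simpl (u ^ S p); field; split; [generalize (den_pos th u Hth); lra|apply INR_fact_neq_0].
- unfold kernel_moment; replace (t + 1 + INR p) with (t + INR (S p)) by (rewrite S_INR; ring).
  replace (- th) with (-1 * th) by ring; rewrite Rpow_mult_distr.
  transitivity ((-1) ^ S p * (-1) ^ S p * (t * poch (t + 1) (S p) / INR (fact (S p)) *
    (th ^ S p * beta_int (S p) th (t + INR (S p))))); [|rewrite sign_sq; ring].
  field; apply INR_fact_neq_0.
Qed.

Lemma kernel_moment_bounds (p : nat) (t th : R) : 0 < t <= 1 -> 0 < th <= 1 ->
  0 <= kernel_moment p t th <= (INR (S p) + 1) * / 4 ^ p.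
Proof.
intros Ht Hth; unfold kernel_moment.
destruct (beta_int_bounds p th t Hth ltac:(lra)) as [B0 B1].
assert (F := INR_fact_lt_0 (S p)).
destruct (poch_le (S p) (t + 1) (1 + 1) ltac:(lra)) as [C0 C1].
(* The worst case is t = 1, where the product 2 * 3 * ... is (p+2)!. *)
assert (E : poch (1 + 1) (S p) / INR (fact (S p)) = INR (S p) + 1).
{ generalize (poch_fact (S p) 1); simpl (INR 1); simpl (fact 1); simpl (INR 1); rewrite Rmult_1_r.
  intros ->; change (1 + S p)%nat with (S (S p)).
  rewrite fact_simpl, mult_INR, <- S_INR; field; apply INR_fact_neq_0. }
assert (D : 0 <= t * poch (t + 1) (S p) / INR (fact (S p)) <= INR (S p) + 1).
{ split; [apply Rdiv_le_0_compat; [apply Rmult_le_pos; lra|exact F]|].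
  rewrite <- E; apply Rmult_le_compat_r; [left; now apply Rinv_0_lt_compat|].
  rewrite <- (Rmult_1_l (poch (1 + 1) (S p))); apply Rmult_le_compat; lra. }
split; [now apply Rmult_le_pos|apply Rmult_le_compat; lra].
Qed.

Definition power_quotient (t u : R) : R := (1 - pw u t) / (1 - u).

(** The kernel is the derivative in th of -(u/den)^t / (1-u), where u/den runs from 1 at th = 0 to u
    at th = 1. It decreases in th from t/u, whence an error that is not uniform near u = 0. *)
Lemma power_quotient_mean (N : nat) (t u : R) : 0 < t <= 1 -> 0 < u < 1 ->
  0 <= power_quotient t u - mean N (fun th => kernel t th u) <= / u / INR (S N).
Proof.
intros Ht Hu.
assert (D : forall th, 0 <= th <= 1 -> u <= den th u <= 1) by (unfold den; intros; nra).
destruct (mean_antitone_bounds (fun th => - / (1 - u) * pw (u / den th u) t)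
  (fun th => kernel t th u) N) as [A B].
- intros th Hth; specialize (D th Hth).
  assert (Pz : 0 < u / den th u) by (apply Rdiv_lt_0_compat; lra).
  replace (kernel t th u) with
    (- / (1 - u) * (- u * (1 - u) / den th u ^ 2 * (t * pw (u / den th u) (t - 1)))).
  + apply (is_derive_scal (fun th => pw (u / den th u) t)).
    apply (is_derive_comp (fun y => pw y t) (fun th => u / den th u)).
    * now apply is_derive_pw_pos.
    * unfold den in *; auto_derive; [lra|field; lra].
  + unfold kernel, mobius_pw; replace t with (t - 1 + 1) at 4 by ring.
    rewrite pw_succ by lra; field; lra.
- intros x y H0 Hxy H1; unfold kernel, mobius_pw; apply Rmult_le_compat_l; [lra|].
  assert (Dx := D x ltac:(lra)); assert (Dy := D y ltac:(lra)).
  assert (Dxy : den x u <= den y u) by (unfold den; nra).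
  assert (I : / den y u <= / den x u) by (apply Rinv_le_contravar; lra).
  assert (Py : 0 < / den y u) by (apply Rinv_0_lt_compat; lra).
  apply Rmult_le_compat; [apply pw_ge0|lra| |exact I].
  rewrite !pw_pos by (apply Rdiv_lt_0_compat; lra).
  apply exp_le, Rmult_le_compat_l; [lra|]; apply ln_le; [apply Rdiv_lt_0_compat; lra|].
  apply Rmult_le_compat_l; lra.
- assert (D1 : den 1 u = 1) by (unfold den; ring).
  assert (D0 : den 0 u = u) by (unfold den; ring).
  unfold kernel at 2 3 in B; unfold mobius_pw in B; rewrite D0, D1 in A, B.
  replace (u / u) with 1 in A, B by (field; lra); rewrite Rdiv_1_r in A, B.
  rewrite pw_1_l in A, B.
  replace (power_quotient t u) with (- / (1 - u) * pw u t - - / (1 - u) * 1)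
    by (unfold power_quotient; field; lra).
  split; [exact A|apply Rle_trans with (1 := B)].
  apply Rmult_le_compat_r; [left; apply Rinv_0_lt_compat, lt_0_INR; lia|].
  assert (0 <= t * (pw u t / 1)) by (rewrite Rdiv_1_r; apply Rmult_le_pos; [lra|apply pw_ge0]).
  assert (0 < / u) by (apply Rinv_0_lt_compat; lra).
  unfold Rdiv at 1; nra.
Qed.

(** Integrating (1-u^t)/(1-u) over t in [0,1] gives the kernel exactly. The quotient increases in t,
    so the estimate for decreasing functions is applied to its negative. *)
Lemma log_kernel_mean (N : nat) (u : R) : 0 < u < 1 ->
  Rabs (log_kernel u - mean N (fun t => power_quotient t u)) <= 1 / INR (S N).
Proof.
intros Hu; generalize (ln_lt_0 u Hu); intros L.
destruct (mean_antitone_bounds (fun t => - ((t - pw u t / ln u) / (1 - u)))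
  (fun t => -1 * power_quotient t u) N) as [A B].
- intros t _; apply is_derive_ext with (fun t => - ((t - exp (t * ln u) / ln u) / (1 - u))).
  + intros y; now rewrite pw_pos.
  + unfold power_quotient; rewrite pw_pos by lra; auto_derive; [lra|field; lra].
- intros x y H0 Hxy H1; unfold power_quotient.
  assert (pw u y <= pw u x) by (rewrite !pw_pos by lra; apply exp_le; nra).
  assert ((1 - pw u x) / (1 - u) <= (1 - pw u y) / (1 - u));
    [apply Rmult_le_compat_r; [left; apply Rinv_0_lt_compat|]; lra|lra].
- rewrite mean_scal in A, B.
  assert (P1 : pw u 1 = u) by (rewrite <- (pow_1 u) at 2; apply (pw_nat u 1); lra).
  assert (P0 : pw u 0 = 1) by (apply (pw_nat u 0); lra).
  unfold power_quotient at 2 3 in B; rewrite P0, P1 in A, B.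
  replace (- ((1 - u / ln u) / (1 - u)) - - ((0 - 1 / ln u) / (1 - u))) with (- log_kernel u)
    in A, B by (unfold log_kernel; field; lra).
  replace (-1 * ((1 - 1) / (1 - u)) - -1 * ((1 - u) / (1 - u))) with 1 in B by (field; lra).
  rewrite Rabs_left1; lra.
Qed.

Lemma poly_bounded (a : nat -> R) (n : nat) :
  exists C, forall u, 0 < u < 1 -> Rabs (sum_n (fun k => a k * u ^ k) n) <= C.
Proof.
induction n as [|n [C IH]].
- exists (Rabs (a 0%nat)); intros u _; rewrite sum_O; simpl; rewrite Rmult_1_r; lra.
- exists (C + Rabs (a (S n))); intros u Hu; rewrite sum_n_SR.
  apply Rle_trans with (1 := Rabs_triang _ _), Rplus_le_compat; [now apply IH|].
  rewrite Rabs_mult; rewrite <- (Rmult_1_r (Rabs (a (S n)))) at 2.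
  apply Rmult_le_compat_l; [apply Rabs_pos|].
  rewrite Rabs_pos_eq by (apply pow_le; lra).
  rewrite <- (pow1 (S n)); apply pow_incr; lra.
Qed.

(** One factor u of the weight absorbs the 1/u of the inner error and makes the estimate uniform in
    u. *)
Lemma log_kernel_double_mean (p N : nat) (u : R) : 0 < u < 1 ->
  Rabs (u ^ S p * (log_kernel u - mean N (fun t => mean N (fun th => kernel t th u))))
  <= 2 / INR (S N).
Proof.
intros Hu; assert (PM : 0 < / INR (S N)) by (apply Rinv_0_lt_compat, lt_0_INR; lia).
generalize (log_kernel_mean N u Hu); intros A; apply Rabs_le_between in A.
set (r := fun t => power_quotient t u - mean N (fun th => kernel t th u)).
assert (R0 : 0 <= mean N r <= / u / INR (S N)).
{ split; [apply le_mean|apply mean_le]; intros t Ht; now apply power_quotient_mean. }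
replace (mean N (fun t => mean N (fun th => kernel t th u)))
  with (mean N (fun t => power_quotient t u) + -1 * mean N r).
2: { rewrite <- mean_scal, <- mean_plus; unfold mean; f_equal; apply sum_n_extR.
     intros j _; unfold r, mean; ring. }
assert (Hp : 0 <= u ^ p <= 1).
{ split; [apply pow_le; lra|]; rewrite <- (pow1 p); apply pow_incr; lra. }
assert (Hm : 0 <= u * mean N r <= / INR (S N)).
{ split; [apply Rmult_le_pos; lra|].
  apply Rle_trans with (u * (/ u / INR (S N))); [apply Rmult_le_compat_l; lra|].
  right; field; split; [apply not_0_INR; lia|lra]. }
set (y := log_kernel u - mean N (fun t => power_quotient t u)) in *.
replace (_ * _) with (u ^ p * (u * y + u * mean N r)) by (unfold y; simpl; ring).
unfold Rdiv in *; rewrite Rmult_1_l in A.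
assert (B : Rabs (u * y + u * mean N r) <= 2 * / INR (S N)) by (apply Rabs_le; nra).
rewrite Rabs_mult, (Rabs_pos_eq (u ^ p)) by lra.
generalize (Rabs_pos (u * y + u * mean N r)); nra.
Qed.

(** The integral is within a multiple of 1/(N+1) of a double mean of kernel moments, and those
    bounds are uniform in t, th and N. *)
Lemma legendre_integral_0_bounds (n : nat) : (1 <= n)%nat ->
  0 <= legendre_integral n 0 <= (INR n + 1) * / 4 ^ (n - 1).
Proof.
intros Hn; destruct n as [|p]; [lia|]; replace (S p - 1)%nat with p by lia.
destruct (poly_bounded (legendre_coef (S p)) (S p)) as [C HC].
set (w := fun u => u ^ S p * shifted_legendre (S p) u).
assert (HJ : is_RInt (fun u => w u * log_kernel u) 0 1 (legendre_integral (S p) 0)).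
{ apply (RInt_correct (V := R_CompleteNormedModule)), ex_RInt_mul_log_kernel.
  intros u _; apply (continuous_mult (fun u => u ^ S p) (shifted_legendre (S p)));
    [apply continuous_pow|].
  apply (ex_derive_continuous (shifted_legendre (S p))); eexists.
  apply (is_derive_sum_nR (fun k x => legendre_coef (S p) k * x ^ k)).
  intros k; auto_derive; [exact I|reflexivity]. }
assert (A : forall N, Rabs (legendre_integral (S p) 0
    - mean N (fun t => mean N (fun th => kernel_moment p t th))) <= 2 * C / INR (S N)).
{ intros N; apply (is_RInt_close (fun u => w u * log_kernel u)
    (fun u => mean N (fun t => mean N (fun th => w u * kernel t th u)))); [exact HJ| |].
  - apply (is_RInt_mean N (fun t u => mean N (fun th => w u * kernel t th u))); intros t Ht.
    apply (is_RInt_mean N (fun th u => w u * kernel t th u)); intros th Hth.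
    now apply is_RInt_kernel_moment.
  - intros u Hu.
    replace (mean N (fun t => mean N (fun th => w u * kernel t th u)))
      with (w u * mean N (fun t => mean N (fun th => kernel t th u))).
    2: { rewrite <- mean_scal; unfold mean at 1 3; f_equal; apply sum_n_extR.
         intros j _; symmetry; apply mean_scal. }
    unfold w; rewrite !(Rmult_comm (u ^ S p)), !Rmult_assoc, <- Rmult_minus_distr_l, <- Rmult_minus_distr_l.
    rewrite Rabs_mult.
    replace (2 * C / INR (S N)) with (C * (2 / INR (S N))) by (unfold Rdiv; ring).
    apply Rmult_le_compat; try apply Rabs_pos; [now apply HC|now apply log_kernel_double_mean]. }
assert (B : forall N, 0 <= mean N (fun t => mean N (fun th => kernel_moment p t th))
    <= (INR (S p) + 1) * / 4 ^ p).
{ intros N; split; [apply le_mean|apply mean_le]; intros t Ht;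
    [apply le_mean|apply mean_le]; intros th Hth; now apply kernel_moment_bounds. }
split; apply le_eps_harmonic with (2 * C); intros N;
  specialize (A N); specialize (B N); apply Rabs_le_between in A; lra.
Qed.

(** * The fractional part formula and the rationality of gamma *)

Lemma rational_of_frac_formula (n m : nat) : frac_formula n m ->
  exists q : Q, euler_gamma = Q2R q.
Proof.
unfold frac_formula, frac_part; rewrite legendre_integral_eq.
set (d := INR (lcm_upto n)); intros H.
destruct (is_int_lcm_legendre_harmonic n (n - m) ltac:(lia)) as [a Ha]; fold d in Ha.
set (A := sum_n _ n) in Ha; fold A in H.
assert (Hd : 0 < d) by (apply lt_0_INR, lcm_upto_pos).
(* Under the formula the integer part of d (-1)^m L is d (-1)^m (L - J) = d (-1)^m (A - gamma), and
   d A is an integer. *)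
assert (G : is_int (d * euler_gamma)).
{ replace (d * euler_gamma) with
    (d * A + -1 * ((-1) ^ m * IZR (Int_part (d * (-1) ^ m * legendre_log n m)))).
  - apply is_int_plus; [now exists a|].
    apply is_int_mult; [now exists (-1)%Z|].
    apply is_int_mult; [apply is_int_sign|eexists; reflexivity].
  - set (z := IZR (Int_part _)) in *.
    assert (E : - z = d * (-1) ^ m * (euler_gamma - A)) by lra.
    replace z with (- (d * (-1) ^ m * (euler_gamma - A))) by lra.
    transitivity (d * A + (-1) ^ m * (-1) ^ m * (d * (euler_gamma - A))); [ring|].
    rewrite sign_sq; ring. }
destruct G as [z Hz]; exists (Qmake z (Pos.of_nat (lcm_upto n))).
unfold Q2R; simpl.
replace (IZR (Z.pos (Pos.of_nat (lcm_upto n)))) with d.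
- rewrite <- Hz; field; lra.
- unfold d; rewrite INR_IZR_INZ, <- positive_nat_Z, Nat2Pos.id; [reflexivity|].
  generalize (lcm_upto_pos n); lia.
Qed.

Lemma is_int_lcm_rational (q : Q) (n : nat) : (Pos.to_nat (Qden q) <= n)%nat ->
  is_int (INR (lcm_upto n) * Q2R q).
Proof.
intros H; destruct (divide_lcm_upto n (Pos.to_nat (Qden q))) as [c ->].
{ generalize (Pos2Nat.is_pos (Qden q)); lia. }
unfold Q2R; rewrite mult_INR, (INR_IZR_INZ (Pos.to_nat _)), positive_nat_Z.
replace (_ * _) with (INR c * IZR (Qnum q)).
- apply is_int_mult; [apply is_int_INR|eexists; reflexivity].
- field; now apply eq_IZR_contrapositive.
Qed.

Lemma frac_part_unique (x y : R) : is_int (y - x) -> 0 <= y < 1 -> frac_part x = y.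
Proof.
intros [z Hz] Hy; unfold frac_part.
rewrite <- (Int_part_spec x (- z)); rewrite opp_IZR; lra.
Qed.

Lemma frac_formula_of_rational (q : Q) : euler_gamma = Q2R q ->
  exists N, forall n, (N <= n)%nat -> (1 <= n)%nat -> frac_formula n 0.
Proof.
intros Hq; destruct lcm_upto_negligible as [N0 HN0].
(* Beyond [N0] the product d_n J is below 1; beyond the denominator of q, d_n gamma is an
   integer. *)
exists (N0 + Pos.to_nat (Qden q))%nat; intros n Hn H1.
destruct (legendre_integral_0_bounds n H1) as [J0 J1].
assert (Hd : 0 < INR (lcm_upto n)) by (apply lt_0_INR, lcm_upto_pos).
unfold frac_formula; simpl; rewrite Rmult_1_r; apply frac_part_unique.
- rewrite legendre_integral_eq, Hq.
  replace (_ - _) with (INR (lcm_upto n) * Q2R q + -1 * (INR (lcm_upto n) *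
    sum_n (fun k => legendre_coef n k * harmonic (k + (n - 0))) n)) by ring.
  apply is_int_plus; [apply is_int_lcm_rational; lia|].
  apply is_int_mult; [now exists (-1)%Z|apply is_int_lcm_legendre_harmonic; lia].
- split; [apply Rmult_le_pos; lra|].
  apply Rle_lt_trans with (2 := HN0 n ltac:(lia)); apply Rmult_le_compat_l; lra.
Qed.

Theorem theorem2 :
  ((exists n m : nat, (1 <= n)%nat /\ (m <= n)%nat /\ frac_formula n m)
   <->
   (exists m N : nat, forall n : nat,
      (N <= n)%nat -> (1 <= n)%nat -> (m <= n)%nat -> frac_formula n m))
  /\
  ((exists m N : nat, forall n : nat,
      (N <= n)%nat -> (1 <= n)%nat -> (m <= n)%nat -> frac_formula n m)
   <->
   (exists q : Q, euler_gamma = Q2R q)).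
Proof.
assert (ac : (exists n m : nat, (1 <= n)%nat /\ (m <= n)%nat /\ frac_formula n m) ->
  exists q : Q, euler_gamma = Q2R q).
{ intros (n & m & _ & _ & H); now apply rational_of_frac_formula with n m. }
assert (cb : (exists q : Q, euler_gamma = Q2R q) ->
  exists m N : nat, forall n : nat,
    (N <= n)%nat -> (1 <= n)%nat -> (m <= n)%nat -> frac_formula n m).
{ intros [q Hq]; destruct (frac_formula_of_rational q Hq) as [N HN].
  exists 0%nat, N; auto. }
assert (ba : (exists m N : nat, forall n : nat,
    (N <= n)%nat -> (1 <= n)%nat -> (m <= n)%nat -> frac_formula n m) ->
  exists n m : nat, (1 <= n)%nat /\ (m <= n)%nat /\ frac_formula n m).
{ intros (m & N & H); exists (N + m + 1)%nat, m.
  repeat split; [lia|lia|apply H; lia]. }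
tauto.
Qed.
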